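(* Let $(M^{2d+1},\Omega,\alpha)$ be a compact shs manifold whose fundamental group is finite. Then the SMAT shs connections on $(M^{2d+1},\Omega,\alpha)$ are not statistical connections; i.e. no SMAT shs connection $(\nabla,\nabla^* )$ has both $\nabla$ and $\nabla^*$ torsion-free.
   Context: A stable Hamiltonian structure (shs) on a smooth manifold $M^{2d+1}$ is a pair $(\Omega,\alpha)$ with $\Omega$ a closed 2-form and $\alpha$ a 1-form such that $\alpha\wedge\Omega^{d}$ is nowhere zero and $\ker\Omega\subset\ker d\alpha$. Its Reeb vector field $E$ is defined by $i_E\Omega=0$, $i_E\alpha=1$. A Riemannian metric $g$ is compatible with $(\Omega,\alpha)$ if there is an endomorphism field $\Theta$ of $TM$ with $\Theta^2=-I+\alpha\otimes E$, $\Theta E=0$, $\alpha\circ\Theta=0$, $\alpha=g(\cdot,E)$, $g=\Omega(\cdot,\Theta\cdot)+\alpha\otimes\alpha$. An SMAT shs connection is a pair $(\nabla,\nabla^* )$ of linear connections dual with respect to a compatible metric $g$, i.e. $X\,g(Y,Z)=g(\nabla_XY,Z)+g(Y,\nabla^*_XZ)$, with $\nabla$ torsion-free, $\nabla E=0$ and $\nabla\Omega=0$. It is statistical if both $\nabla$ and $\nabla^*$ are torsion-free. Manifolds are without boundary. *)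

(* Defs.v *)
(* MathComp-Analysis; the reals are an arbitrary R : realType. *)
From HB Require Import structures.
From mathcomp Require Import all_boot all_order all_algebra all_fingroup.
From mathcomp Require Import all_classical all_reals all_analysis.

Set Implicit Arguments.
Unset Strict Implicit.
Unset Printing Implicit Defensive.

Import Order.TTheory GRing.Theory Num.Theory.
Import numFieldNormedType.Exports.

Local Open Scope classical_set_scope.
Local Open Scope ring_scope.

(* The constant vector v is quantified outside the recursive call: since the
   source is R^n, x |-> 'd f x is C^k iff x |-> 'd f x v is C^k for every v. *)
Fixpoint Ck_on (R : realType) (n : nat) (W : normedModType R) (k : nat)
    (O : set 'rV[R]_n) (f : 'rV[R]_n -> W) : Prop :=
  match k with
  | 0 => forall x, O x -> {for x, continuous f}
  | k'.+1 => (forall x, O x -> differentiable f x) /\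
             (forall v : 'rV[R]_n, Ck_on k' O (fun x => 'd f x v))
  end.

Definition smooth_near (R : realType) (n : nat) (W : normedModType R)
    (f : 'rV[R]_n -> W) (x : 'rV[R]_n) : Prop :=
  exists O : set 'rV[R]_n, [/\ open O, O x & forall k, Ck_on k O f].

(* A chart is a pair of total functions, only meaningful on chart_dom i and on
   chart i @` chart_dom i respectively.  The atlas comes with a preferred chart
   around each point, used below to identify each tangent space with R^n. *)
Record smooth_manifold (R : realType) (n : nat) (M : topologicalType) := {
  chart_index : Type;
  chart_dom : chart_index -> set M;
  chart : chart_index -> M -> 'rV[R]_n;
  chart_inv : chart_index -> 'rV[R]_n -> M;
  chart_at : M -> chart_index;
  manifold_hausdorff : hausdorff_space M;
  manifold_second_countable : @second_countable M;
  chart_dom_open : forall i, open (chart_dom i);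
  chart_dom_at : forall p, chart_dom (chart_at p) p;
  chart_codom_open : forall i, open (chart i @` chart_dom i);
  chartK : forall i q, chart_dom i q -> chart_inv i (chart i q) = q;
  chart_continuous : forall i q, chart_dom i q -> {for q, continuous (chart i)};
  chart_inv_continuous : forall i q, chart_dom i q ->
    {for chart i q, continuous (chart_inv i)};
  transition_smooth : forall i j q, chart_dom i q -> chart_dom j q ->
    smooth_near (chart j \o chart_inv i) (chart i q)
}.

Section FundamentalGroup.
Variables (R : realType) (M : topologicalType).

Definition loop_at (p : M) (f : R -> M) : Prop :=
  [/\ {within `[0, 1], continuous f}, f 0 = p & f 1 = p].

Definition loop_homotopic (p : M) (f g : R -> M) : Prop :=
  exists H : R * R -> M,
    [/\ {within `[0, 1] `*` `[0, 1], continuous H},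
        forall t : R, 0 <= t <= 1 -> H (0, t) = f t,
        forall t : R, 0 <= t <= 1 -> H (1, t) = g t &
        forall s : R, 0 <= s <= 1 -> H (s, 0) = p /\ H (s, 1) = p].

(* The underlying set of pi_1(M, p): homotopy classes of loops.  Only its
   cardinality is needed, so that the group law is not defined. *)
Definition pi1 (p : M) : set (set (R -> M)) :=
  [set [set g | loop_at p g /\ loop_homotopic p f g] | f in loop_at p].

Definition finite_fundamental_group : Prop :=
  forall p : M, finite_set (pi1 p).

End FundamentalGroup.

Section TensorFields.
Variables (R : realType) (n : nat) (M : topologicalType).
Variable A : smooth_manifold R n M.

(* T_p M is R^n, a vector being given by its components in the chart
   chart_at A p. *)
Local Notation T := 'rV[R]_n.

Definition vector_field := M -> T.

(* The representation of X in the chart i, as a function on R^n. *)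
Definition vf_rep (i : chart_index A) (X : vector_field) (y : T) : T :=
  let q := chart_inv i y in
  'd (chart i \o chart_inv (chart_at A q)) (chart (chart_at A q) q) (X q).

(* Smoothness of functions and of vector fields is local: it is required in
   some neighbourhood of p only, so that fields smooth near p stand for local
   sections around p. *)
Definition smooth_fun (f : M -> R) (p : M) : Prop :=
  smooth_near (f \o chart_inv (chart_at A p)) (chart (chart_at A p) p).

Definition smooth_vf (X : vector_field) (p : M) : Prop :=
  smooth_near (vf_rep (chart_at A p) X) (chart (chart_at A p) p).

(* (X f)(p) *)
Definition vf_deriv (X : vector_field) (f : M -> R) (p : M) : R :=
  'd (f \o chart_inv (chart_at A p)) (chart (chart_at A p) p) (X p).

Definition lie_bracket (X Y : vector_field) : vector_field := fun p =>
  let c := chart_at A p in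
  'd (vf_rep c Y) (chart c p) (X p) - 'd (vf_rep c X) (chart c p) (Y p).

Definition bilinear_form (b : T -> T -> R) : Prop :=
  (forall w, scalar (b ^~ w)) /\ (forall v, scalar (b v)).

Definition smooth_bilinear (b : M -> T -> T -> R) : Prop :=
  (forall p, bilinear_form (b p)) /\
  (forall p X Y, smooth_vf X p -> smooth_vf Y p ->
     smooth_fun (fun q => b q (X q) (Y q)) p).

Definition one_form (a : M -> T -> R) : Prop :=
  (forall p, scalar (a p)) /\
  (forall p X, smooth_vf X p -> smooth_fun (fun q => a q (X q)) p).

Definition two_form (w : M -> T -> T -> R) : Prop :=
  smooth_bilinear w /\ (forall p v, w p v v = 0).

Definition endomorphism_field (Th : M -> T -> T) : Prop :=
  (forall p, linear (Th p)) /\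
  (forall p X, smooth_vf X p -> smooth_vf (fun q => Th q (X q)) p).

Definition riemannian_metric (g : M -> T -> T -> R) : Prop :=
  [/\ smooth_bilinear g, (forall p v w, g p v w = g p w v) &
      (forall p (v : T), v != 0 -> 0 < g p v v)].

(* (da)(X, Y) *)
Definition ext_d1 (a : M -> T -> R) (X Y : vector_field) (p : M) : R :=
  vf_deriv X (fun q => a q (Y q)) p - vf_deriv Y (fun q => a q (X q)) p
  - a p (lie_bracket X Y p).

(* (dw)(X, Y, Z) *)
Definition ext_d2 (w : M -> T -> T -> R) (X Y Z : vector_field) (p : M) : R :=
  vf_deriv X (fun q => w q (Y q) (Z q)) p
  - vf_deriv Y (fun q => w q (X q) (Z q)) p
  + vf_deriv Z (fun q => w q (X q) (Y q)) p
  - w p (lie_bracket X Y p) (Z p)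
  + w p (lie_bracket X Z p) (Y p)
  - w p (lie_bracket Y Z p) (X p).

Definition closed_two_form (w : M -> T -> T -> R) : Prop :=
  two_form w /\
  (forall p X Y Z, smooth_vf X p -> smooth_vf Y p -> smooth_vf Z p ->
     ext_d2 w X Y Z p = 0).

(* Koszul's axioms, at every point p and for fields smooth near p.  They make
   the value of nabla X Y at p depend only on X p and on the germ of Y at p, so
   that this is an ordinary connection acting on local sections; its values on
   fields that are not smooth near p are irrelevant. *)
Definition linear_connection
    (nabla : vector_field -> vector_field -> vector_field) : Prop :=
  [/\ (forall p f X X' Y, smooth_fun f p -> smooth_vf X p -> smooth_vf X' p ->
         smooth_vf Y p ->
         nabla (fun q => f q *: X q + X' q) Y p
         = f p *: nabla X Y p + nabla X' Y p),
      (forall p X Y Y', smooth_vf X p -> smooth_vf Y p -> smooth_vf Y' p ->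
         nabla X (fun q => Y q + Y' q) p = nabla X Y p + nabla X Y' p),
      (forall p f X Y, smooth_fun f p -> smooth_vf X p -> smooth_vf Y p ->
         nabla X (fun q => f q *: Y q) p
         = vf_deriv X f p *: Y p + f p *: nabla X Y p) &
      (forall p X Y, smooth_vf X p -> smooth_vf Y p ->
         smooth_vf (nabla X Y) p)].

Definition torsion_free
    (nabla : vector_field -> vector_field -> vector_field) : Prop :=
  forall p X Y, smooth_vf X p -> smooth_vf Y p ->
    nabla X Y p - nabla Y X p = lie_bracket X Y p.

Definition dual_connections (g : M -> T -> T -> R)
    (nabla nablas : vector_field -> vector_field -> vector_field) : Prop :=
  forall p X Y Z, smooth_vf X p -> smooth_vf Y p -> smooth_vf Z p ->
    vf_deriv X (fun q => g q (Y q) (Z q)) p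
    = g p (nabla X Y p) (Z p) + g p (Y p) (nablas X Z p).

Definition parallel_vf
    (nabla : vector_field -> vector_field -> vector_field)
    (E : vector_field) : Prop :=
  forall p X, smooth_vf X p -> nabla X E p = 0.

Definition parallel_two_form
    (nabla : vector_field -> vector_field -> vector_field)
    (w : M -> T -> T -> R) : Prop :=
  forall p X Y Z, smooth_vf X p -> smooth_vf Y p -> smooth_vf Z p ->
    vf_deriv X (fun q => w q (Y q) (Z q)) p
    - w p (nabla X Y p) (Z p) - w p (Y p) (nabla X Z p) = 0.

End TensorFields.

Section Wedge.
Variables (R : realType) (T : Type).

(* Forms of degree k on a single vector space, as functions of k vectors. *)
Definition kform (k : nat) := ('I_k -> T) -> R.

Definition wedge (k l : nat) (a : kform k) (b : kform l) : kform (k + l) :=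
  fun v => (k`! * l`!)%:R^-1 *
    \sum_(s : 'S_(k + l)) (-1) ^+ s *
      (a (fun i => v (s (lshift l i))) * b (fun j => v (s (rshift k j)))).

Definition kform1 (a : T -> R) : kform 1 := fun v => a (v ord0).
Definition kform2 (w : T -> T -> R) : kform 2 := fun v => w (v ord0) (v ord_max).

Fixpoint wedge_pow (w : kform 2) (d : nat) : kform d.*2 :=
  match d with
  | 0 => fun _ => 1
  | d'.+1 => wedge w (@wedge_pow w d')
  end.

End Wedge.

Arguments wedge_pow {R T} w d.

Section StableHamiltonian.
Variables (R : realType) (d : nat) (M : topologicalType).
Variable A : smooth_manifold R d.*2.+1 M.

Local Notation T := 'rV[R]_(d.*2.+1).

Definition stable_hamiltonian (Omega : M -> T -> T -> R) (alpha : M -> T -> R)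
    : Prop :=
  [/\ closed_two_form A Omega,
      one_form A alpha,
      (forall p, exists v : 'I_(1 + d.*2) -> T,
         wedge (kform1 (alpha p)) (wedge_pow (kform2 (Omega p)) d) v != 0) &
      (forall p X, smooth_vf A X p -> (forall w, Omega p (X p) w = 0) ->
         forall Y, smooth_vf A Y p -> ext_d1 A alpha X Y p = 0)].

Definition reeb_field (Omega : M -> T -> T -> R) (alpha : M -> T -> R)
    (E : M -> T) : Prop :=
  [/\ (forall p, smooth_vf A E p), (forall p w, Omega p (E p) w = 0) &
      (forall p, alpha p (E p) = 1)].

Definition compatible_metric (Omega : M -> T -> T -> R) (alpha : M -> T -> R)
    (E : M -> T) (g : M -> T -> T -> R) : Prop :=
  riemannian_metric A g /\
  exists Th : M -> T -> T,
    endomorphism_field A Th /\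
    forall p,
      [/\ (forall v, Th p (Th p v) = - v + alpha p v *: E p),
          Th p (E p) = 0,
          (forall v, alpha p (Th p v) = 0),
          (forall v, alpha p v = g p v (E p)) &
          (forall v w, g p v w = Omega p v (Th p w) + alpha p v * alpha p w)].

Definition SMAT_connection (Omega : M -> T -> T -> R) (alpha : M -> T -> R)
    (E : M -> T) (nabla nablas : (M -> T) -> (M -> T) -> (M -> T)) : Prop :=
  [/\ linear_connection A nabla /\ linear_connection A nablas,
      (exists2 g, compatible_metric Omega alpha E g
                & dual_connections A g nabla nablas),
      torsion_free A nabla,
      parallel_vf A nabla E &
      parallel_two_form A nabla Omega].

Definition statistical (nabla nablas : (M -> T) -> (M -> T) -> (M -> T))
    : Prop :=
  torsion_free A nabla /\ torsion_free A nablas.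

End StableHamiltonian.

(* Main.v *)
Require Import Defs.
From HB Require Import structures.
From mathcomp Require Import all_boot all_order all_algebra.
From mathcomp Require Import all_classical all_reals all_analysis.
From mathcomp Require Import ring lra.
Import Order.TTheory GRing.Theory Num.Theory.
Import numFieldNormedType.Exports.
Local Open Scope classical_set_scope.
Local Open Scope ring_scope.

(** If both connections were torsion-free, the 1-form alpha = g(E, .) would be
    closed: duality and nabla E = 0 give X (alpha Y) = alpha (nabla*_X Y), so that
    d alpha measures the torsion of nabla*, seen through alpha
    ([parallel_dual_form_closed]).  On a compact manifold with finite fundamental
    group a closed 1-form is exact, hence vanishes at a maximum of its primitive
    ([closed_form_vanishes]); but alpha(E) = 1 everywhere.

    The exactness is obtained without path integrals.  Around each point q, alpha
    has a primitive, which gives an increment delta q q' for q' near q, additive in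
    the sense that delta q q'' = delta q q' + delta q' q'' for q'' near q'.  This
    is a purely topological structure: the product of M and the line gets a finer
    topology, whose neighbourhoods of (q, x) contain the points
    (q', x + delta q q') for q' near q.  The projection to M is a covering, and its
    continuous paths are the pairs (path, primitive along this path).  Paths
    lift ([path_lift]), and homotopic loops have lifts with the same endpoint
    ([homotopy_lift]).  If a loop had a nonzero period c, its powers would have the
    distinct periods n c and there would be infinitely many homotopy classes; so
    all the periods are zero ([loop_period0]) and the endpoint of a lift
    depends on the endpoints of the path only ([global_primitive]).

    The local primitives come from the Poincare lemma on a ball of a chart: the
    radial integral of a C^1 form with symmetric derivative is a primitive of it
    ([radial_integral_derive], [C1_diff]).  The closedness hypothesis is easily read
    at q in the preferred chart of q, where constant fields are smooth with zero
    bracket ([form_rep_closed_base]).  At the other points of a fixed chart it is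
    transported by the transition map; the second derivatives of this map enter,
    and cancel by Schwarz's theorem ([form_rep_closed]). *)

Set Implicit Arguments.
Unset Strict Implicit.

(** * Lifting paths *)

(** Used below for real values and for propositions alike: a property of a
    parameter which is locally independent of it can be moved along an interval. *)
Lemma locally_constant_itv (R : realType) (X : Type) (a b : R) (f : R -> X) :
  (forall t, a <= t <= b -> \forall s \near t, a <= s <= b -> f s = f t) ->
  forall s t, a <= s <= b -> a <= t <= b -> f s = f t.
Proof.
move=> lc s0 t0 s0ab t0ab.
have := @segment_connected R a b.
move=> /(_ [set t | a <= t <= b /\ f t = f t0]) H.
suff : [set t | a <= t <= b /\ f t = f t0] = `[a, b]%classic.
  move=> E; have : `[a, b]%classic s0 by rewrite /= in_itv.
  by rewrite -E => -[].
apply: H.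
- by exists t0.
- exists [set t | \forall s \near t, a <= s <= b -> f s = f t0].
    rewrite openE => t /= Ht; rewrite /interior.
    by move: Ht => /near_join.
  apply/seteqP; split=> t /=; rewrite in_itv /=.
    move=> [tab ft]; split=> //.
    by near=> s; rewrite -ft; near: s; exact: lc.
  by move=> [tab] /nbhs_singleton /(_ tab).
- exists (~` [set t | \forall s \near t, a <= s <= b -> f s <> f t0]).
    apply: open_closedC; rewrite openE => t /= Ht; rewrite /interior.
    by move: Ht => /near_join.
  apply/seteqP; split=> t /=; rewrite in_itv /=.
    move=> [tab ft]; split=> //.
    by move=> /nbhs_singleton /(_ tab).
  move=> [tab nt]; split=> //; apply: contrapT => ft; apply: nt.
  by near=> s => sab; rewrite (near (lc t tab) s) .
Unshelve. all: by end_near. Qed.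

(** Continuity of paths is only about a family N of neighbourhood filters, so that
    the same lemmas serve for paths in M and for their lifts to leaves. *)
Section Paths.
Variables (R : realType) (E : Type) (N : E -> set_system E).
Hypothesis N_mem : forall e V, N e V -> V e.

Definition path_on (a b : R) (L : R -> E) :=
  forall t, a <= t <= b -> forall V, N (L t) V ->
    \forall s \near t, a <= s <= b -> V (L s).

Definition linked (e e' : E) :=
  exists L : R -> E, [/\ path_on 0 1 L, L 0 = e & L 1 = e'].

Lemma path_on_sub a b a' b' L : a <= a' -> b' <= b ->
  path_on a b L -> path_on a' b' L.
Proof.
move=> aa bb HL t /andP[at_ tb] V NV.
have tab : a <= t <= b by rewrite (le_trans aa at_) (le_trans tb bb).
have H := HL t tab V NV.
near=> s => /andP[as_ sb]; apply: (near H s) => //.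
by rewrite (le_trans aa as_) (le_trans sb bb).
Unshelve. all: by end_near. Qed.

Lemma path_on_comp a b a' b' (h : R -> R) L : continuous h ->
  (forall t, a' <= t <= b' -> a <= h t <= b) ->
  path_on a b L -> path_on a' b' (L \o h).
Proof.
move=> hc hab HL t tab V NV.
have H : \forall s \near t, a <= h s <= b -> V (L (h s)).
  exact: (hc t _ (HL (h t) (hab t tab) V NV)).
by near=> s => sab; apply: (near H s) => //; exact: hab.
Unshelve. all: by end_near. Qed.

Lemma path_on_glue a b c L L' : a <= b -> b <= c -> L b = L' b ->
  path_on a b L -> path_on b c L' ->
  path_on a c (fun t => if t <= b then L t else L' t).
Proof.
move=> ab bc Lb HL HL' t /andP[at_ tc] V.
case: (ltgtP t b) => [tb|bt|tb] NV.
- have H := HL t (introT andP (conj at_ (ltW tb))) V NV.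
  have tb' : \forall s \near t, s < b by exact: lt_nbhsl.
  near=> s => /andP[as_ sc].
  have sb : s <= b by apply/ltW/(near tb' s).
  by rewrite sb; apply: (near H s) => //; rewrite as_.
- have H := HL' t (introT andP (conj (ltW bt) tc)) V NV.
  have tb' : \forall s \near t, b < s by exact: lt_nbhsr.
  near=> s => /andP[as_ sc].
  have sb : b < s by exact: (near tb' s).
  by rewrite leNgt sb /=; apply: (near H s) => //; rewrite (ltW sb) sc.
- subst t.
  have H := HL b (introT andP (conj at_ (lexx _))) V NV.
  have H' : \forall s \near b, b <= s <= c -> V (L' s).
    by apply: (HL' b); rewrite ?lexx ?bc // -Lb.
  near=> s => /andP[as_ sc]; case: (leP s b) => sb.
    by apply: (near H s) => //; rewrite as_ sb.
  by apply: (near H' s) => //; rewrite (ltW sb) sc.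
Unshelve. all: by end_near. Qed.

Lemma linked_refl e : linked e e.
Proof.
exists (fun=> e); split=> // t _ V NV.
by near=> s => _; apply: N_mem.
Unshelve. all: by end_near. Qed.

Lemma linked_sym e e' : linked e e' -> linked e' e.
Proof.
move=> [L [HL L0 L1]]; exists (L \o (fun t => 1 - t)); split.
- apply: path_on_comp HL => [t|t tab]; last lra.
  by apply: cvgB; [apply: cvg_cst|apply: cvg_id].
- by rewrite /= subr0.
- by rewrite /= subrr.
Qed.

Lemma linked_trans e e' e'' : linked e e' -> linked e' e'' -> linked e e''.
Proof.
move=> [L [HL L0 L1]] [L' [HL' L0' L1']].
exists (fun t => if t <= 2^-1 then (L \o (fun t => 2 * t)) t
         else (L' \o (fun t => 2 * t - 1)) t); split; rewrite /=.
- apply: path_on_glue; rewrite /=.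
  + lra.
  + lra.
  + by rewrite divff ?pnatr_eq0 // subrr L1 L0'.
  + apply: path_on_comp HL => [t|t tab]; last lra.
    by apply: cvgM; [apply: cvg_cst|apply: cvg_id].
  + apply: path_on_comp HL' => [t|t tab]; last lra.
    by apply: cvgB; [apply: cvgM; [apply: cvg_cst|apply: cvg_id]|apply: cvg_cst].
- by rewrite invr_ge0 ler0n mulr0.
- have -> : (1 <= 2^-1 :> R) = false by apply/negbTE; rewrite -ltNge; lra.
  by rewrite -L1'; congr L'; lra.
Qed.

End Paths.

(** * Leaves of a locally exact increment *)

Section Leaves.
Variables (R : realType) (M : topologicalType) (delta : M -> M -> R).
Hypothesis cocycle : forall q, \forall q' \near q, \forall q'' \near q',
  delta q q'' = delta q q' + delta q' q''.

(** The neighbourhoods of e in the leaf topology on the product of M and R. *)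
Definition leaf (e : M * R) : set_system (M * R) :=
  [set V | \forall q \near e.1, V (q, e.2 + delta e.1 q)].

Lemma delta_self q : delta q q = 0.
Proof.
have /nbhs_singleton/nbhs_singleton/eqP := cocycle q.
by rewrite -subr_eq0 opprD addNKr oppr_eq0 => /eqP.
Qed.

Lemma leaf_mem e V : leaf e V -> V e.
Proof.
by move=> /nbhs_singleton; rewrite delta_self addr0; case: e.
Qed.

(** Wherever the increments from a fixed q are additive, they lift the paths. *)
Lemma leaf_path_local (q : M) x a b (g : R -> M) : path_on (@nbhs M M) a b g ->
  (forall t, a <= t <= b ->
    \forall q' \near g t, delta q q' = delta q (g t) + delta (g t) q') ->
  path_on leaf a b (fun t => (g t, delta q (g t) + x)).
Proof.
move=> Hg Hc t tab V NV.
suff /(Hg t tab) : \forall q' \near g t, V (q', delta q q' + x) by [].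
near=> q'.
have -> : delta q q' = delta q (g t) + delta (g t) q' by near: q'; exact: Hc.
by rewrite addrAC; near: q'; exact: NV.
Unshelve. all: by end_near. Qed.

Lemma leaf_path_fst a b (L : R -> M * R) : path_on leaf a b L ->
  path_on (@nbhs M M) a b (fst \o L).
Proof.
move=> HL t tab V NV.
by apply: (HL t tab [set e | V e.1]); rewrite /leaf /=; near=> q; near: q.
Unshelve. all: by end_near. Qed.

Lemma leaf_path_shift a b (L : R -> M * R) x : path_on leaf a b L ->
  path_on leaf a b (fun t => ((L t).1, (L t).2 + x)).
Proof.
move=> HL t tab V NV.
apply: (HL t tab [set e | V (e.1, e.2 + x)]); rewrite /leaf /=.
by near=> q; rewrite addrAC; near: q.
Unshelve. all: by end_near. Qed.

Lemma leaf_path_unique a b (g : R -> M) F G :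
  path_on leaf a b (fun t => (g t, F t)) ->
  path_on leaf a b (fun t => (g t, G t)) ->
  forall s t, a <= s <= b -> a <= t <= b -> F s - G s = F t - G t.
Proof.
move=> HF HG; apply: locally_constant_itv => t tab.
have leafE H : leaf (g t, H t) [set e | e.2 = H t + delta (g t) e.1].
  by rewrite /leaf /=; near=> q.
have HF' := HF t tab _ (leafE F); have HG' := HG t tab _ (leafE G).
near=> s => sab.
have -> : F s = F t + delta (g t) (g s) by exact: (near HF' s).
have -> : G s = G t + delta (g t) (g s) by exact: (near HG' s).
ring.
Unshelve. all: by end_near. Qed.

(** The lifts over an initial segment of [0, 1] extend across a small interval
    around each of its points; that the path lifts up to time t is therefore a
    locally constant property of t. *)
Lemma path_lift (g : R -> M) x : path_on (@nbhs M M) 0 1 g ->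
  exists2 F : R -> R, F 0 = x & path_on leaf 0 1 (fun t => (g t, F t)).
Proof.
move=> Hg.
pose P t := exists2 F : R -> R, F 0 = x & path_on leaf 0 t (fun t => (g t, F t)).
have Pmono a b : a <= b -> P b -> P a.
  by move=> ab [F F0 HF]; exists F => //; exact: path_on_sub HF.
have P0 : P 0.
  exists (fun=> x) => // t t0 V /leaf_mem V0.
  have t00 : t = 0 by lra.
  by near=> s => s0; have -> : s = t by lra.
suff P01 : P 0 = P 1 by rewrite P01 in P0.
apply: (@locally_constant_itv _ _ 0 1 P); rewrite ?lexx ?ler01 // => t t01.
have : \forall s \near t, 0 <= s <= 1 ->
    \forall q' \near g s, delta (g t) q' = delta (g t) (g s) + delta (g s) q'.
  exact: (Hg t t01 _ (cocycle (g t))).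
move=> /nbhs_ballP [e /= e0 He].
have Pext a b : ball t e a -> ball t e b -> 0 <= a -> a <= b -> b <= 1 ->
    P a -> P b.
  move=> ta tb a0 ab b1 [F F0 HF].
  exists (fun s => if s <= a then F s else
      delta (g t) (g s) + (F a - delta (g t) (g a))); first by rewrite a0.
  have -> : (fun s => (g s, if s <= a then F s else
      delta (g t) (g s) + (F a - delta (g t) (g a)))) =
    (fun s => if s <= a then (g s, F s) else
      (g s, delta (g t) (g s) + (F a - delta (g t) (g a)))).
    by apply/funext => s; case: ifP.
  apply: path_on_glue => //; first by rewrite addrC subrK.
  apply: leaf_path_local; first by apply: path_on_sub Hg.
  move=> s /andP[as_ sb]; apply: He; last by rewrite (le_trans a0) ?(le_trans sb).
  move: ta tb; rewrite /ball /= !ltr_distl; lra.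
have te : \forall s \near t, ball t e s by exact: nbhsx_ballx.
near=> s => s01.
have ts : ball t e s by exact: (near te s).
have tt : ball t e t by exact: ballxx.
apply/propext; case: (leP s t) => st; split.
- by apply: Pext => //; lra.
- exact: Pmono.
- by apply: Pmono; exact: ltW.
- by apply: Pext => //; lra.
Unshelve. all: by end_near. Qed.

(** The end value F s 1 is locally constant in s.  Near a given s0, consider
    the property P t that F s t - F s0 t is the increment from H s0 t to H s t, for
    all s near s0.  It is locally constant in t, because for t near t1 all of these
    values follow the increments from H s0 t1.  It holds at t = 0, and at t = 1 it
    says that F s 1 = F s0 1. *)
Lemma homotopy_lift (H : R -> R -> M) (F : R -> R -> R) (p p' : M) :
  (forall s t, 0 <= s <= 1 -> 0 <= t <= 1 -> forall V, nbhs (H s t) V ->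
    \forall u \near (s, t), 0 <= u.1 <= 1 -> 0 <= u.2 <= 1 -> V (H u.1 u.2)) ->
  (forall s, 0 <= s <= 1 -> H s 0 = p /\ H s 1 = p') ->
  (forall s, 0 <= s <= 1 -> F s 0 = 0 /\
    path_on leaf 0 1 (fun t => (H s t, F s t))) ->
  F 0 1 = F 1 1.
Proof.
move=> Hc Hp HF.
have i0 : 0 <= (0 : R) <= (1 : R) by rewrite lexx ler01.
have i1 : (0 : R) <= (1 : R) <= 1 by rewrite lexx ler01.
apply: (@locally_constant_itv _ _ 0 1 (fun s => F s 1)) => // s0 s01.
pose P t := \forall s \near s0, 0 <= s <= 1 ->
  F s t = F s0 t + delta (H s0 t) (H s t).
have P0 : P 0.
  near=> s => sI; have [-> _] := HF s sI; have [-> _] := HF s0 s01.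
  by have [-> _] := Hp s sI; have [-> _] := Hp s0 s01; rewrite delta_self addr0.
suff P01 : P 0 = P 1.
  rewrite P01 in P0; near=> s => sI.
  rewrite (near P0 s) //.
  by have [_ ->] := Hp s sI; have [_ ->] := Hp s0 s01; rewrite delta_self addr0.
apply: (@locally_constant_itv _ _ 0 1 P) => // t1 t1I.
set q1 := H s0 t1.
have /nbhs_ballP [e /= e0 He] := Hc _ _ s01 t1I _ (cocycle q1).
have {}He s t : ball s0 e s -> ball t1 e t -> 0 <= s <= 1 -> 0 <= t <= 1 ->
    \forall q' \near H s t, delta q1 q' = delta q1 (H s t) + delta (H s t) q'.
  by move=> bs bt sI tI; apply: (He (s, t)).
have Fdiff s t t' : ball s0 e s -> 0 <= s <= 1 -> ball t1 e t -> 0 <= t <= 1 ->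
    ball t1 e t' -> 0 <= t' <= 1 -> t <= t' ->
    F s t - (delta q1 (H s t) + 0) = F s t' - (delta q1 (H s t') + 0).
  move=> bs sI bt tI bt' tI' tt'.
  have [_ Fs] := HF s sI.
  apply: (@leaf_path_unique t t' (H s) (F s)
      (fun t => delta q1 (H s t) + 0)); rewrite ?lexx ?tt' //.
    by apply: path_on_sub Fs; lra.
  apply: leaf_path_local.
    by apply: (@path_on_sub _ _ _ 0 1); [lra|lra|exact: (leaf_path_fst Fs)].
  move=> u utt'; apply: He => //; last lra.
  move: bt bt'; rewrite /ball /= !ltr_distl; lra.
have bs0 : ball s0 e s0 by exact: ballxx.
have bnear : \forall s \near s0, ball s0 e s by exact: nbhsx_ballx.
have Pimp t t' : ball t1 e t -> 0 <= t <= 1 ->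
    ball t1 e t' -> 0 <= t' <= 1 -> P t -> P t'.
  move=> bt tI bt' tI'.
  have nd u : ball t1 e u -> 0 <= u <= 1 -> \forall s \near s0, 0 <= s <= 1 ->
      delta q1 (H s u) = delta q1 (H s0 u) + delta (H s0 u) (H s u).
    move=> bu uI.
    have /nbhs_ballP [r /= r0 Hr] :=
      Hc _ _ s01 uI _ (He _ _ bs0 bu s01 uI).
    apply/nbhs_ballP; exists r => //= s bs sI.
    by apply: (Hr (s, u)) => //; split=> //=; exact: ballxx.
  have nt := nd t bt tI; have nt' := nd t' bt' tI'.
  move=> Pt; near=> s => sI.
  have bs : ball s0 e s by exact: (near bnear s).
  have E : F s t = F s0 t + delta (H s0 t) (H s t) by exact: (near Pt s).
  have E1 : delta q1 (H s t) = delta q1 (H s0 t) + delta (H s0 t) (H s t)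
    by exact: (near nt s).
  have E2 : delta q1 (H s t') = delta q1 (H s0 t') + delta (H s0 t') (H s t')
    by exact: (near nt' s).
  case: (leP t t') => tt'.
    have A1 := Fdiff s t t' bs sI bt tI bt' tI' tt'.
    have A2 := Fdiff s0 t t' bs0 s01 bt tI bt' tI' tt'.
    lra.
  have A1 := Fdiff s t' t bs sI bt' tI' bt tI (ltW tt').
  have A2 := Fdiff s0 t' t bs0 s01 bt' tI' bt tI (ltW tt').
  lra.
have bt1 : ball t1 e t1 by exact: ballxx.
have btnear : \forall t \near t1, ball t1 e t by exact: nbhsx_ballx.
near=> t => tI; have bt : ball t1 e t by exact: (near btnear t).
by apply/propext; split; exact: Pimp.
Unshelve. all: by end_near. Qed.

Lemma linked_shift p q x y z : linked R leaf (p, x) (q, y) ->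
  linked R leaf (p, x + z) (q, y + z).
Proof.
move=> [L [HL L0 L1]]; exists (fun t => ((L t).1, (L t).2 + z)).
by split; [exact: leaf_path_shift|rewrite L0|rewrite L1].
Qed.

Hypothesis pi1_finite : finite_fundamental_group R M.

(** The n-th power of a loop of period c has period n c.  Two of these powers are
    homotopic, hence have the same period. *)
Lemma loop_period0 p c : linked R leaf (p, 0) (p, c) -> c = 0.
Proof.
move=> Lc.
have Ln n : linked R leaf (p, 0) (p, c *+ n).
  elim: n => [|n IH]; first exact: linked_refl leaf_mem _.
  apply: (linked_trans IH).
  by have := linked_shift (c *+ n) Lc; rewrite add0r -mulrS.
have /choice [L HL] := Ln.
pose g n := fst \o L n.
have gpath n : path_on (@nbhs M M) 0 1 (g n).
  by have [HL0 _ _] := HL n; exact: leaf_path_fst.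
have gloop n : loop_at p (g n).
  have [HL0 L0 L1] := HL n; split; rewrite /g /= ?L0 ?L1 //.
  apply/subspace_continuousP => t; rewrite /= in_itv /= => tI V NV.
  have := gpath n t tI V NV.
  by apply: filterS => s Hs /=; rewrite in_itv.
pose cl n : set (R -> M) := [set h | loop_at p h /\ loop_homotopic p (g n) h].
have grefl n : loop_homotopic p (g n) (g n).
  exists (fun u => g n u.2); split=> //.
    apply/subspace_continuousP => -[s t]; rewrite /= !in_itv /= => -[sI tI] V NV.
    have /nbhs_ballP [e /= e0 He] := gpath n t tI V NV.
    apply/nbhs_ballP; exists e => //= -[s' t'] [/= _ bt]; rewrite !in_itv /=.
    by move=> -[_ t'I]; exact: He.
  by move=> s _; have [_ ? ?] := gloop n.
have [n [m [nm Enm]]] : exists n m : nat, n != m /\ cl n = cl m.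
  have cfin := pi1_finite p.
  have : ~ {in setT &, injective cl}.
    move=> inj.
    have : finite_set (cl @` setT).
      apply: sub_finite_set cfin => _ [n _ <-]; exists (g n) => //.
    by rewrite (eq_finite_set (inj_card_eq inj)); exact: infinite_nat.
  move=> ninj; apply: contrapT => nex; apply: ninj => n m _ _ E.
  by apply/eqP; apply: contrapT => /negP nm; apply: nex; exists n, m.
have [_ [K [Kc K0 K1 Kp]]] : cl n (g m) by rewrite Enm.
pose H s t := K (s, t).
have Hc s t : 0 <= s <= 1 -> 0 <= t <= 1 -> forall V, nbhs (H s t) V ->
    \forall u \near (s, t), 0 <= u.1 <= 1 -> 0 <= u.2 <= 1 -> V (H u.1 u.2).
  move=> sI tI V NV.
  move/subspace_continuousP : Kc => /(_ (s, t)); rewrite /= !in_itv /=.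
  move=> /(_ (conj sI tI) V NV) /nbhs_ballP [e /= e0 He].
  apply/nbhs_ballP; exists e => //= -[s' t'] bst /= sI' tI'.
  by apply: (He _ bst); rewrite /= !in_itv.
have Hpath s : 0 <= s <= 1 -> path_on (@nbhs M M) 0 1 (H s).
  move=> sI t tI V NV.
  have /nbhs_ballP [e /= e0 He] := Hc s t sI tI V NV.
  apply/nbhs_ballP; exists e => //= t' bt tI'.
  by apply: (He (s, t')) => //; split => //=; exact: ballxx.
have : forall s, exists F : R -> R, 0 <= s <= 1 -> F 0 = 0 /\
    path_on leaf 0 1 (fun t => (H s t, F t)).
  move=> s; have [sI|] := pselect (0 <= s <= 1).
    by have [F F0 HF] := path_lift 0 (Hpath s sI); exists F.
  by move=> nsI; exists (fun=> 0).
move=> /choice [F HF].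
have F01 := homotopy_lift Hc Kp HF.
have i0 : 0 <= (0 : R) <= (1 : R) by rewrite lexx ler01.
have i1 : (0 : R) <= (1 : R) <= 1 by rewrite lexx ler01.
have Fend k s : 0 <= s <= 1 -> (forall t, 0 <= t <= 1 -> H s t = g k t) ->
    F s 1 = c *+ k.
  move=> sI Hs; have [Fs0 Fs] := HF s sI; have [Lk Lk0 Lk1] := HL k.
  have := @leaf_path_unique 0 1 (H s) (F s) (snd \o L k) Fs _ 1 0 i1 i0.
  rewrite /= Lk0 Lk1 Fs0 /= subrr => E; apply/eqP; rewrite -subr_eq0 E //.
  move=> t tI V; rewrite (Hs t tI) /g /= -surjective_pairing => NV.
  have := Lk t tI V NV; apply: filterS => u Hu uI.
  by rewrite (Hs u uI) /g /= -surjective_pairing; exact: Hu.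
have := F01; rewrite (Fend n 0 i0) // (Fend m 1 i1) // => /eqP.
rewrite -subr_eq0; case: (ltngtP n m) nm => // nm _.
  rewrite -opprB oppr_eq0 -mulrnBr ?(ltnW nm) //.
  by rewrite mulrn_eq0 subn_eq0 leqNgt nm /= => /eqP.
rewrite -mulrnBr ?(ltnW nm) //.
by rewrite mulrn_eq0 subn_eq0 leqNgt nm /= => /eqP.
Qed.

Hypothesis linked_near : forall q, \forall q' \near q,
  linked R leaf (q, 0) (q', delta q q').

(** The primitive at q is the period of any path from the base point of the path
    component of q.  The base point is chosen in the class of all points linked
    to q, which is the same set for nearby points. *)
Lemma global_primitive (p0 : M) :
  exists phi : M -> R, forall q, \forall q' \near q, phi q' = phi q + delta q q'.
Proof.
pose cls q := [set p | exists c, linked R leaf (p, 0) (q, c)].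
pose b q := xget p0 (cls q).
have bP q : cls q (b q).
  by apply: xgetPex; exists q, 0; exact: linked_refl leaf_mem _.
have /choice [phi Hphi] := bP.
exists phi => q; have := linked_near q; apply: filterS => q' qq'.
have Ecls : cls q = cls q'.
  apply/seteqP; split=> p [c pc].
    exists (delta q q' + c); apply: (linked_trans pc).
    by have := linked_shift c qq'; rewrite add0r.
  exists (c - delta q q').
  apply: (linked_trans pc); apply: linked_sym.
  have E : delta q q' + (c - delta q q') = c by ring.
  by have := linked_shift (c - delta q q') qq'; rewrite add0r E.
have Eb : b q = b q' by rewrite /b Ecls.
have L1 := linked_shift (phi q) qq'.
rewrite add0r in L1.
have L2 := linked_trans (Hphi q) L1.
have L3 := linked_sym (Hphi q').
rewrite -Eb in L3.
have L4 := linked_shift (delta q q' + phi q - phi q') L3.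
have E : phi q' + (delta q q' + phi q - phi q') = delta q q' + phi q by ring.
rewrite add0r E in L4.
have := loop_period0 (linked_trans L2 L4).
lra.
Qed.

End Leaves.

(** * Differentiation along lines and symmetry of second derivatives *)

Section Lines.
Variables (R : realType) (V : normedModType R).

Lemma is_derive_line (W : normedModType R) (f : V -> W) (x v : V) (t : R) df :
  is_derive (x + t *: v) v f df -> is_derive t 1 (fun t => f (x + t *: v)) df.
Proof.
have E : (fun h : R => h^-1 *: (f (h *: v + (x + t *: v)) - f (x + t *: v))) =
  (fun h : R => h^-1 *: (f (x + (h *: 1 + t) *: v) - f (x + t *: v))).
  by apply/funext => h; rewrite scalerDl [h *: 1]mulr1 addrCA.
by move=> [D <-]; split; rewrite /derivable /derive -E.
Qed.

Lemma is_derive_translate (W : normedModType R) (f : V -> W) (x c v : V) df :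
  is_derive (x + c) v f df -> is_derive x v (fun x => f (x + c)) df.
Proof.
have E : (fun h : R => h^-1 *: (f (h *: v + (x + c)) - f (x + c))) =
  (fun h : R => h^-1 *: (f (h *: v + x + c) - f (x + c))).
  by apply/funext => h; rewrite addrA.
by move=> [D <-]; split; rewrite /derivable /derive -E.
Qed.

Lemma MVT_line (f f' : V -> R) (x v : V) (s : R) : 0 < s ->
  (forall t, 0 <= t <= s -> is_derive (x + t *: v) v f (f' (x + t *: v))) ->
  exists2 t, 0 < t < s & f (x + s *: v) - f x = s * f' (x + t *: v).
Proof.
move=> s0 H.
have H' t : 0 <= t <= s ->
    is_derive t 1 (fun t => f (x + t *: v)) (f' (x + t *: v)).
  by move=> ts; apply: is_derive_line; exact: H.
have [||] := @MVT R (fun t => f (x + t *: v)) (fun t => f' (x + t *: v)) 0 s s0.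
- by move=> t; rewrite in_itv /= => /andP[t0 ts]; apply: H'; rewrite !ltW.
- apply: derivable_within_continuous => t; rewrite in_itv /= => ts.
  by have [] := H' t ts.
- move=> t; rewrite in_itv /= => ts; rewrite scale0r addr0 subr0 => ->.
  by exists t => //; rewrite mulrC.
Qed.

(** The mean value theorem, in the direction v for y |-> f (y + s w) - f y and then
    in the direction w. *)
Lemma second_difference (f f1 f12 : V -> R) (x v w : V) (e s : R) : 0 < s ->
  s * `|v| + s * `|w| < e ->
  (forall y, ball x e y -> is_derive y v f (f1 y)) ->
  (forall y, ball x e y -> is_derive y w f1 (f12 y)) ->
  exists2 y, ball x e y & (f (x + s *: v + s *: w) - f (x + s *: v)) -
    (f (x + s *: w) - f x) = s * (s * f12 y).
Proof.
move=> s0 se H1 H2.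
have inb t u : 0 <= t <= s -> 0 <= u <= s -> ball x e (x + t *: v + u *: w).
  move=> /andP[t0 ts] /andP[u0 us].
  rewrite -ball_normE /ball_ /= -addrA opprD addNKr normrN.
  apply: le_lt_trans se; apply: (le_trans (ler_normD _ _)).
  by rewrite !normrZ !ger0_norm // lerD // ler_wpM2r.
have s_ : 0 <= s <= s by rewrite lexx ltW.
have z_ : 0 <= (0 : R) <= s by rewrite lexx ltW.
have [t ts E1] : exists2 t, 0 < t < s &
    (f (x + s *: v + s *: w) - f (x + s *: v)) - (f (x + s *: w) - f x) =
    s * (f1 (x + t *: v + s *: w) - f1 (x + t *: v)).
  have := @MVT_line (fun y => f (y + s *: w) - f y)
    (fun y => f1 (y + s *: w) - f1 y) x v s s0; apply.
  move=> t ts; have b0 := inb t s ts s_; have b1 := inb t 0 ts z_.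
  rewrite scale0r addr0 in b1.
  have D1 := H1 _ b1.
  have D2 := is_derive_translate (H1 _ b0).
  exact: is_deriveB.
have [u us E2] : exists2 u, 0 < u < s &
    f1 (x + t *: v + s *: w) - f1 (x + t *: v) =
    s * f12 (x + t *: v + u *: w).
  apply: MVT_line => // u us; apply: H2; apply: inb => //.
  by case/andP: ts => ? ?; rewrite !ltW.
exists (x + t *: v + u *: w); last by rewrite E1 E2.
by apply: inb; [case/andP: ts|case/andP: us] => ? ?; rewrite !ltW.
Qed.

(** Both mixed derivatives, at points close to x, compute the same second
    difference, which is symmetric in v and w. *)
Lemma schwarz (f fv fw fvw fwv : V -> R) (x v w : V) :
  (\forall y \near x, is_derive y v f (fv y)) ->
  (\forall y \near x, is_derive y w f (fw y)) ->
  (\forall y \near x, is_derive y w fv (fvw y)) ->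
  (\forall y \near x, is_derive y v fw (fwv y)) ->
  {for x, continuous fvw} -> {for x, continuous fwv} -> fvw x = fwv x.
Proof.
move=> Hv Hw Hvw Hwv cvw cwv; apply/eqP; rewrite -subr_eq0 -normr_eq0.
apply: contrapT => /negP; rewrite -normr_gt0 normr_id => d0.
set d := `|fvw x - fwv x| in d0.
have d20 : 0 < d / 2 by rewrite divr_gt0.
have N1 : \forall y \near x, `|fvw x - fvw y| < d / 2.
  by move/cvgrPdist_lt : cvw; apply.
have N2 : \forall y \near x, `|fwv x - fwv y| < d / 2.
  by move/cvgrPdist_lt : cwv; apply.
have /nbhs_ballP [e /= e0 He] : \forall y \near x,
  [/\ is_derive y v f (fv y), is_derive y w f (fw y),
     is_derive y w fv (fvw y) & is_derive y v fw (fwv y)] /\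
  (`|fvw x - fvw y| < d / 2 /\ `|fwv x - fwv y| < d / 2).
  by near=> y; split; split; near: y.
(* the added 1 keeps the denominator positive when v = w = 0 *)
pose k := `|v| + `|w| + 1.
have k0 : 0 < k by rewrite ltr_wpDl.
pose s := e / k.
have s0 : 0 < s by rewrite divr_gt0.
have se : s * `|v| + s * `|w| < e.
  rewrite -mulrDr -[ltRHS](@divfK _ k) ?gt_eqF // -/s ltr_pM2l //.
  by rewrite /k ltrDl.
have [y yb E1] := @second_difference f fv fvw x v w e s s0 se
  (fun y yb => let: conj (And4 a _ _ _) _ := He y yb in a)
  (fun y yb => let: conj (And4 _ _ a _) _ := He y yb in a).
have se' : s * `|w| + s * `|v| < e by rewrite addrC.
have [z zb E2] := @second_difference f fw fwv x w v e s s0 se'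
  (fun y yb => let: conj (And4 _ a _ _) _ := He y yb in a)
  (fun y yb => let: conj (And4 _ _ _ a) _ := He y yb in a).
have E : fvw y = fwv z.
  apply: (mulfI (lt0r_neq0 s0)); apply: (mulfI (lt0r_neq0 s0)).
  by rewrite -E1 -E2 (addrAC x (s *: v)); ring.
have [_ [A1 _]] := He y yb; have [_ [_ A2]] := He z zb.
rewrite E in A1.
have : d < d.
  rewrite {1}/d (_ : fvw x - fwv x = (fvw x - fwv z) - (fwv x - fwv z)); last ring.
  apply: le_lt_trans (ler_normB _ _) _.
  by rewrite (splitr d) ltrD.
by rewrite ltxx.
Unshelve. all: by end_near. Qed.

End Lines.

(** * Differentials in normed spaces *)

(** Stated as a conjunction rather than with is_diff, since it is mostly used to
    rewrite 'd g. *)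
Lemma near_eq_diff (R : numFieldType) (V W : normedModType R) (f g : V -> W) x :
  (\forall y \near x, f y = g y) -> differentiable f x ->
  differentiable g x /\ 'd g x = 'd f x :> (V -> W).
Proof.
move=> fg df.
have [dc Ho] := (@diff_locallyP _ _ _ x f).1 df.
have Go : g \o shift x = cst (g x) + ('d f x : V -> W) +o_ (0 : V) id.
  have gfx : g x = f x by rewrite (nbhs_singleton fg).
  move: Ho => /eqaddoP Ho; apply/eqaddoP => eps eps0.
  have := Ho eps eps0.
  move/nbhs_ballP : fg => [r /= r0 Hr].
  apply: filterS2 (nbhs0_lt r0) => h hr.
  have -> // : (g \o shift x - (cst (g x) + 'd f x : V -> W)) h =
      (f \o shift x - (cst (f x) + 'd f x : V -> W)) h.
  rewrite !fctE /= gfx -Hr // -ball_normE /ball_ /=.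
  by rewrite opprD addrCA subrr addr0 normrN.
have dE := diff_unique dc Go.
have dg : differentiable g x.
  by apply/diff_locallyP; rewrite dE; exact: (conj dc Go).
by [].
Qed.

Lemma near_eq_continuous (T U : topologicalType) (f g : T -> U) (x : T) :
  (\forall y \near x, f y = g y) -> {for x, continuous f} -> {for x, continuous g}.
Proof.
move=> fg fc; change (g @ x --> g x); rewrite -(nbhs_singleton fg).
by apply: cvg_trans fc; exact: (near_eq_cvg fg).
Qed.

Lemma continuous_sum_fun (R : realType) (T : topologicalType) m
    (f : 'I_m -> T -> R) (x : T) :
  (forall i, {for x, continuous (f i)}) ->
  {for x, continuous (fun y => \sum_i f i y)}.
Proof.
move=> fc.
have -> : (fun y => \sum_i f i y) = \sum_i f i.
  by apply/funext => y; rewrite fct_sumE.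
apply: (big_ind (fun g : T -> R => {for x, continuous g})); last first.
- by move=> i _; exact: fc.
- by move=> g h gc hc; exact: (continuousD gc hc).
- exact: (@cst_continuous T R 0).
Qed.

Lemma is_derive_diff (R : numFieldType) (V W : normedModType R) (f : V -> W) x v :
  differentiable f x -> is_derive x v f ('d f x v).
Proof. by move=> df; split; [exact: diff_derivable|rewrite deriveE]. Qed.

Lemma diff_derive_val (R : numFieldType) (V W : normedModType R) (f : V -> W) x v df :
  differentiable f x -> is_derive x v f df -> 'd f x v = df.
Proof. by move=> dfx [_ <-]; rewrite deriveE. Qed.

Lemma is_derive_chain (R : numFieldType) (U V W : normedModType R) (f : U -> V)
    (g : V -> W) x v :
  differentiable f x -> differentiable g (f x) ->
  is_derive x v (g \o f) ('d g (f x) ('d f x v)).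
Proof.
move=> df dg; have dgf := differentiable_comp df dg.
split; first by apply: diff_derivable; exact: dgf.
rewrite deriveE; last exact: dgf.
exact: ((congr1 (fun h : U -> W => h v) (diff_comp df dg))).
Qed.

Lemma is_derive_coord (R : realFieldType) (V : normedModType R) m n
  (f : V -> 'M[R]_(m, n)) x v df i j :
  is_derive x v f df -> is_derive x v (fun y => f y i j) (df i j).
Proof.
move=> [D <-]; split; first by move/derivable_mxP : D; apply.
by rewrite derive_mx // mxE.
Qed.

Lemma is_derive_sum_fun (R : realType) (V W : normedModType R) m
    (f : 'I_m -> V -> W) (df : 'I_m -> W) x v :
  (forall i, is_derive x v (f i) (df i)) ->
  is_derive x v (fun y => \sum_i f i y) (\sum_i df i).
Proof.
move=> H.
have -> : (fun y => \sum_i f i y) = \sum_i f i.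
  by apply/funext => y; rewrite fct_sumE.
have D i : derivable (f i) x v by have [] := H i.
split; first exact: derivable_sum.
by rewrite derive_sum //; apply: eq_bigr => i _; have [_ ->] := H i.
Qed.

(** * The Poincare lemma for one-forms *)

Section Radial.
Variables (R : realType) (n : nat).
Local Notation V := 'rV[R]_n.
Local Notation mu := (@lebesgue_measure R).

Lemma is_derive_line0 (W : normedModType R) (f : V -> W) (x v : V) df :
  is_derive (0 : R) (1 : R) (fun t : R => f (x + t *: v)) df -> is_derive x v f df.
Proof.
have E : (fun h : R => h^-1 *: (f (x + (h *: 1 + 0) *: v) - f (x + 0 *: v))) =
  (fun h : R => h^-1 *: (f (h *: v + x) - f x)).
  by apply/funext => h; rewrite addr0 [h *: 1]mulr1 scale0r addr0 [x + _]addrC.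
by move=> [D <-]; split; rewrite /derivable /derive -E.
Qed.

Lemma bounded_on_closed_ball (g : V -> R) (x : V) (r e : R) : r < e ->
  (forall z, ball x e z -> {for z, continuous g}) ->
  exists2 C, 0 <= C & forall z, `|x - z| <= r -> `|g z| <= C.
Proof.
move=> re gc.
pose K := closed_ball_ Num.norm x r.
have Kc : compact K.
  apply: bounded_closed_compact.
    exists (r + `|x|); split; first exact: num_real.
    move=> C rC z /= zr; apply: le_trans (ltW rC).
    by rewrite -[z](subKr x) (le_trans (ler_normB _ _)) // addrC lerD2r.
  exact: closed_closed_ball_.
have : bounded_set (g @` K).
  apply: compact_bounded; apply: continuous_compact => //.
  apply: continuous_in_subspaceT => z; rewrite inE => Kz; apply: gc.
  by rewrite -ball_normE /ball_ /= (le_lt_trans Kz).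
move=> [C [_ HC]]; exists (`|C| + 1); first by rewrite addr_ge0.
move=> z zK; apply: HC; last by exists z.
by rewrite (le_lt_trans (ler_norm _)) // ltrDl.
Qed.

Lemma continuous_line (g : V -> R) (x v : V) (t : R) :
  {for x + t *: v, continuous g} -> {for t, continuous (fun t : R => g (x + t *: v))}.
Proof.
move=> gc; apply: (@continuous_comp _ _ _ (fun t : R => x + t *: v) g) => //.
by apply: cvgD; [exact: cvg_cst|exact: scalel_continuous].
Qed.

Section PoincareLemma.
Variables (a : V -> V -> R) (y0 : V) (e : R).
Hypothesis a_lin : forall z, scalar (a z).
Hypothesis a_diff : forall z v, ball y0 e z -> differentiable (a^~ v) z.
Hypothesis a_C1 : forall z v w, ball y0 e z ->
  {for z, continuous (fun z => 'd (a^~ v) z w)}.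
Hypothesis a_sym : forall z v w, ball y0 e z ->
  'd (a^~ v) z w = 'd (a^~ w) z v.

(** The integral of the form a along the segment from y0 to y. *)
Definition radial_integral (y : V) : R :=
  \int[mu]_(t in `[0%R, 1%R]) a (y0 + t *: (y - y0)) (y - y0).

Lemma a_cont z v : ball y0 e z -> {for z, continuous (a^~ v)}.
Proof. by move=> bz; apply: differentiable_continuous; exact: a_diff. Qed.

Lemma itv01_integrable (f : R -> R) :
  (forall t, 0 <= t <= 1 -> {for t, continuous f}) ->
  mu.-integrable `[0%R, 1%R] (EFin \o f).
Proof.
move=> fc; apply: continuous_compact_integrable; first exact: segment_compact.
by apply: continuous_in_subspaceT => t; rewrite inE /= in_itv /=; exact: fc.
Qed.

(** Write x = y0 + t (u + s h) with u = y - y0.  By the symmetry of the derivative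
    of a, the derivative at s = 0 of the integrand a(x)(u + s h) is also the
    derivative in t of t a(y0 + t u)(h); so the derivative of the integral is
    a(y)(h), the increment of the latter between t = 0 and t = 1. *)
Lemma radial_integral_derive y h : ball y0 e y ->
  is_derive y h radial_integral (a y h).
Proof.
move=> yB; set u := y - y0.
have ue : `|u| < e by move: yB; rewrite -ball_normE /ball_ /= distrC.
have alin z v w k : a z (v + k *: w) = a z v + k * a z w.
  by rewrite addrC a_lin /= addrC.
(* eps bounds |s| so that the segments stay in the ball of radius r < e, on
   which the derivatives of a are bounded *)
pose r := (`|u| + e) / 2.
have re : r < e by rewrite /r; lra.
pose eps := (r - `|u|) / (`|h| + 1).
have h1 : 0 < `|h| + 1 by rewrite ltr_wpDl.
have eps0 : 0 < eps by rewrite divr_gt0 // /r; lra.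
have epsr : `|u| + eps * `|h| <= r.
  have -> : r = `|u| + eps * (`|h| + 1) by rewrite divfK ?gt_eqF // addrC subrK.
  by rewrite lerD2l ler_pM2l // lerDl.
have inK (s t : R) : `|s| <= eps -> 0 <= t <= 1 ->
    `|y0 - (y0 + t *: (u + s *: h))| <= r.
  move=> se /andP[t0 t1]; rewrite opprD addNKr normrN normrZ ger0_norm //.
  apply: le_trans (ler_piMl _ t1) _ => //.
  apply: le_trans epsr; apply: le_trans (ler_normD _ _) _.
  by rewrite lerD2l normrZ ler_wpM2r.
have inB (s t : R) : `|s| <= eps -> 0 <= t <= 1 -> ball y0 e (y0 + t *: (u + s *: h)).
  by move=> se t01; rewrite -ball_normE /ball_ /= (le_lt_trans (inK s t se t01)).
have [C1 C1_0 HC1] := bounded_on_closed_ball re (fun z bz => @a_C1 z u h bz).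
have [C2 C2_0 HC2] := bounded_on_closed_ball re (fun z bz => @a_C1 z h h bz).
have [C3 C3_0 HC3] := bounded_on_closed_ball re (fun z bz => @a_cont z h bz).
pose f s t := a (y0 + t *: (u + s *: h)) (u + s *: h).
pose df s t := t * 'd (a^~ u) (y0 + t *: (u + s *: h)) h
  + (s * (t * 'd (a^~ h) (y0 + t *: (u + s *: h)) h)
     + a (y0 + t *: (u + s *: h)) h).
have fder (s t : R) : `|s| <= eps -> 0 <= t <= 1 ->
    is_derive s (1 : R) (f ^~ t) (df s t).
  move=> se t01.
  have fE : f ^~ t = (fun s => a ((y0 + t *: u) + s *: (t *: h)) u) +
      id * (fun s => a ((y0 + t *: u) + s *: (t *: h)) h).
    apply/funext => s'; rewrite /f alin !fctE.
    by rewrite !scalerDr !addrA !scalerA (mulrC s' t).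
  have xE : y0 + t *: (u + s *: h) = (y0 + t *: u) + s *: (t *: h).
    by rewrite scalerDr addrA !scalerA mulrC.
  have D v : is_derive s (1 : R) (fun s => a ((y0 + t *: u) + s *: (t *: h)) v)
      (t * 'd (a^~ v) (y0 + t *: (u + s *: h)) h).
    apply: (@is_derive_line _ _ _ (a^~ v)).
    have dv := a_diff v (inB s t se t01).
    split; rewrite -xE; first exact: diff_derivable.
    by rewrite deriveE // linearZ.
  rewrite fE; apply: is_derive_eq.
  by rewrite /df /= -xE; rewrite [_%:A]mulr1 addrC.
suff H : is_derive (0 : R) (1 : R) (fun s => \int[mu]_(t in `[0%R, 1%R]) f s t) (a y h).
  apply: is_derive_line0.
  have -> // : (fun s : R => radial_integral (y + s *: h)) =
      (fun s => \int[mu]_(t in `[0%R, 1%R]) f s t).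
  by apply/funext => s; rewrite /radial_integral /f addrAC.
have I0 : `](- eps), eps[%classic (0 : R) by rewrite /= in_itv /= oppr_lt0 eps0.
have int_f (s : R) : `](- eps), eps[%classic s ->
    mu.-integrable `[0%R, 1%R] (EFin \o f s).
  rewrite /= in_itv /= => /andP[s1 s2].
  have se : `|s| <= eps by rewrite ler_norml !ltW.
  apply: itv01_integrable => t t01.
  apply: (@continuous_line (a^~ (u + s *: h)) y0 (u + s *: h) t).
  by apply: a_cont; exact: inB.
have sI s : `](- eps), eps[%classic s -> `|s| <= eps.
  by rewrite /= in_itv /= => /andP[s1 s2]; rewrite ler_norml !ltW.
have derf s t : `](- eps), eps[%classic s -> `[0%R, 1%R]%classic t ->
    derivable (f ^~ t) s 1.
  rewrite [X in _ -> X -> _]/= in_itv /= => /sI se t01.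
  by have [] := fder s t se t01.
have d1f s t : `|s| <= eps -> 0 <= t <= 1 -> partial1of2 f s t = df s t.
  by move=> se t01; rewrite partial1of2E; have [_ ->] := fder s t se t01.
pose C := C1 + (eps * C2 + C3).
have C_0 : 0 <= C by rewrite !addr_ge0 // mulr_ge0 // ltW.
have C_int : mu.-integrable `[0%R, 1%R] (EFin \o cst C).
  by apply: itv01_integrable => t _; exact: cst_continuous.
have C_ub s t : `](- eps), eps[%classic s -> `[0%R, 1%R]%classic t ->
    `|partial1of2 f s t| <= cst C t.
  rewrite [X in _ -> X -> _]/= in_itv /= => /sI se t01.
  have zK := inK s t se t01; rewrite d1f // /df /C.
  have [t0 t1] := andP t01.
  have le_t (x D : R) : `|x| <= D -> `|t * x| <= D.
    move=> xD; rewrite normrM ger0_norm //.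
    by apply: le_trans xD; rewrite ler_piMl.
  apply: le_trans (ler_normD _ _) _; apply: lerD; first by apply: le_t; exact: HC1.
  apply: le_trans (ler_normD _ _) _; apply: lerD; last exact: HC3.
  by rewrite normrM ler_pM //; apply: le_t; exact: HC2.
have mI : measurable (`[0%R, 1%R]%classic : set (measurableTypeR R)).
  exact: measurable_itv.
have F_der := @derivable_under_integral R _ _ mu f _ mI 0 _ _ I0 int_f derf
  (cst C) (fun=> C_0) C_int C_ub.
have F_val := @differentiation_under_integral R _ _ mu f _ mI 0 _ _ I0 int_f derf
  (cst C) (fun=> C_0) C_int C_ub.
split => //; rewrite -derive1E F_val.
have z_ : `|0 : R| <= eps by rewrite normr0 ltW.
have uB t : 0 <= t <= 1 -> ball y0 e (y0 + t *: u).
  by move=> t01; have := inB 0 t z_ t01; rewrite scale0r addr0.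
pose b t := t * 'd (a^~ h) (y0 + t *: u) u + a (y0 + t *: u) h.
rewrite (@eq_Rintegral _ _ _ mu _ b); last first.
  move=> t; rewrite inE /= in_itv /= => t01.
  by rewrite d1f // /df mul0r add0r scale0r addr0 a_sym //; exact: uB.
pose B t := t * a (y0 + t *: u) h.
have B_der (t : R) : 0 <= t <= 1 -> is_derive t (1 : R) B (b t).
  move=> t01.
  have D : is_derive t (1 : R) (fun t => a (y0 + t *: u) h)
      ('d (a^~ h) (y0 + t *: u) u).
    apply: (@is_derive_line _ _ _ (a^~ h)).
    have dv := a_diff h (uB t t01).
    by split; [exact: diff_derivable|rewrite deriveE].
  have -> : B = id * (fun t => a (y0 + t *: u) h) by [].
  apply: is_derive_eq; rewrite /b [_ *: 1]mulr1.
  by congr (_ + _).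
have b_cont (t : R) : 0 <= t <= 1 -> {for t, continuous b}.
  move=> t01; apply: cvgD.
    apply: cvgM; first exact: cvg_id.
    exact: (@continuous_line (fun z => 'd (a^~ h) z u) y0 u t (a_C1 (uB t t01))).
  apply: (@continuous_line (a^~ h) y0 u t).
  by apply: a_cont; exact: uB.
have B_cont (t : R) : 0 <= t <= 1 -> {for t, continuous B}.
  move=> t01; have [dB _] := B_der t t01.
  exact/differentiable_continuous/derivable1_diffP.
rewrite /Rintegral (@continuous_FTC2 _ b B 0 1) //=.
- by rewrite /B mul0r subr0 mul1r scale1r addrC subrK.
- apply: continuous_in_subspaceT => t; rewrite inE /= in_itv /=; exact: b_cont.
- split.
  + move=> t; rewrite in_itv /= => /andP[t0 t1].
    have t01 : 0 <= t <= 1 by rewrite !ltW.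
    by have [] := B_der t t01.
  + by apply: cvg_at_right_filter; apply: B_cont; rewrite lexx ler01.
  + by apply: cvg_at_left_filter; apply: B_cont; rewrite lexx ler01.
- move=> t; rewrite in_itv /= => /andP[t0 t1].
  have t01 : 0 <= t <= 1 by rewrite !ltW.
  by rewrite derive1E; have [_ ->] := B_der t t01.
Qed.

End PoincareLemma.
End Radial.

Section C1Diff.
Variables (R : realType) (n : nat).
Local Notation V := 'rV[R]_n.

Lemma scalar_coordE (b : V -> R) h : scalar b ->
  b h = \sum_i h ord0 i * b (delta_mx ord0 i).
Proof.
move=> lb.
pose bM := GRing.isLinear.Build R V R *%R b lb.
pose bL : {scalar V} := HB.pack b bM.
rewrite {1}[h]row_sum_delta -[b]/(bL : V -> R) linear_sum.
by apply: eq_bigr => i _; rewrite linearZ.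
Qed.

Lemma norm_coord_le (h : V) i : `|h ord0 i| <= `|h|.
Proof.
rewrite [leRHS]/Num.norm /= mx_normrE.
by apply: le_trans; last exact: (le_bigmax _ _ (ord0, i)).
Qed.

Lemma scalar_continuous (b : V -> R) : scalar b -> continuous b.
Proof.
move=> lb.
have -> : b = fun h => \sum_i h ord0 i * b (delta_mx ord0 i).
  by apply/funext => h; exact: scalar_coordE.
move=> x; apply: continuous_sum_fun => i.
apply: continuousM; first exact: coord_continuous.
exact: (@cst_continuous V R).
Qed.

(** Continuous partial derivatives give a differential: by the mean value theorem
    F (y + h) - F y = a(y + t h)(h), which is compared to a(y)(h) in coordinates. *)
Lemma C1_diff (F : V -> R) (a : V -> V -> R) (y : V) :
  (forall z, scalar (a z)) ->
  (\forall z \near y, forall h, is_derive z h F (a z h)) ->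
  (forall h, {for y, continuous (a^~ h)}) ->
  is_diff y F (a y).
Proof.
move=> la HF ac.
pose bM := GRing.isLinear.Build R V R *%R (a y) (la y).
pose bL : {linear V -> R^o} := HB.pack (a y : V -> R^o) bM.
have bc : continuous bL by exact: (scalar_continuous (la y)).
have Fo : (F : V -> R^o) \o shift y = cst (F y) + (bL : V -> R^o) +o_ (0 : V) id.
  apply/eqaddoP => eta eta0.
  have k0 : 0 < eta / (n%:R + 1) by rewrite divr_gt0 // ltr_wpDl.
  pose P i z := `|a y (delta_mx ord0 i) - a z (delta_mx ord0 i)| < eta / (n%:R + 1).
  have near_a : \forall z \near y, forall i, P i z.
    apply: (@filter_forall _ _ (fun i => P i) (nbhs y)) => i.
    by move/cvgrPdist_lt : (ac (delta_mx ord0 i)); apply.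
  have /nbhs_ballP [e /= e0 He] : \forall z \near y,
      (forall h, is_derive z h F (a z h)) /\ forall i, P i z.
    by near=> z; split; near: z.
  apply: (filterS _ (nbhs0_lt e0)) => h he.

  have inb t : 0 <= t <= 1 -> ball y e (y + t *: h).
    move=> /andP[t0 t1]; rewrite -ball_normE /ball_ /= opprD addNKr normrN normrZ.
    by rewrite ger0_norm // (le_lt_trans _ he) // ler_piMl.
  have [|t t01 E] := @MVT_line _ _ F (a^~ h) y h 1 ltr01.
    by move=> t t01; have [] := He _ (inb t t01).
  have {}t01 : 0 <= t <= 1 by case/andP: t01 => ? ?; rewrite !ltW.
  rewrite scale1r mul1r in E.
  have -> : (F \o shift y - (cst (F y) + bL)) h = a (y + t *: h) h - a y h.
    by rewrite !fctE /= -E opprD addrA [h + y]addrC.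
  rewrite (scalar_coordE h (la y)) (scalar_coordE h (la _)) -sumrB.
  apply: le_trans (ler_norm_sum _ _ _) _.
  apply: (@le_trans _ _ (\sum_(i < n) `|h| * (eta / (n%:R + 1)))).
    apply: ler_sum => i _; rewrite -mulrBr normrM ler_pM ?norm_coord_le //.
    by rewrite distrC ltW //; have [_] := He _ (inb t t01); apply.
  rewrite sumr_const card_ord -mulrnAr mulrC ler_wpM2r //.
  rewrite -mulr_natr mulrAC ler_pdivrMr ?ltr_wpDl // ler_pM2l //.
  by rewrite lerDl.
have dE := diff_unique bc Fo.
apply: DiffDef => //; apply/diff_locallyP; rewrite dE; split=> //.
Unshelve. all: by end_near. Qed.

End C1Diff.

(** * Charts and transition maps *)

Lemma Ck_on_eq (R : realType) n (W : normedModType R) k O (f g : 'rV[R]_n -> W) :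
  open O -> (forall x, O x -> f x = g x) -> Ck_on k O f -> Ck_on k O g.
Proof.
move=> oO; elim: k f g => [|k IH] f g fg /=.
  move=> fc x Ox; apply: near_eq_continuous (fc x Ox).
  have nO : \forall y \near x, O y by exact: open_nbhs_nbhs.
  by near=> y; apply: fg; exact: (near nO y).
move=> [df Cf].
have dg x : O x -> differentiable g x /\ 'd g x = 'd f x :> (_ -> W).
  move=> Ox; apply: near_eq_diff; last exact: df.
  have nO : \forall y \near x, O y by exact: open_nbhs_nbhs.
  by near=> y; apply: fg; exact: (near nO y).
split=> [x Ox|v]; first by have [] := dg x Ox.
apply: IH (Cf v) => x Ox.
exact/esym/(congr1 (fun h : _ -> W => h v) (dg x Ox).2).
Unshelve. all: by end_near. Qed.

Lemma Ck_on_cst (R : realType) n (W : normedModType R) k O (w : W) :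
  Ck_on k O (fun _ : 'rV[R]_n => w).
Proof.
elim: k w => [|k IH] w /=; first by move=> x _; exact: cst_continuous.
split=> [x _|v]; first exact: differentiable_cst.
have -> : (fun x : 'rV[R]_n => 'd (fun=> w) x v) = (fun=> 0).
  by apply/funext => x; rewrite diff_cst.
exact: IH.
Qed.

Section Charts.
Variables (R : realType) (n : nat) (M : topologicalType).
Variable A : smooth_manifold R n M.
Local Notation V := 'rV[R]_n.
Implicit Types (i j k : chart_index A) (q : M) (v w y : V).

Definition transition i j : V -> V := chart j \o chart_inv i.

Lemma chart_invK i y : (chart i @` chart_dom i) y ->
  chart_dom i (chart_inv i y) /\ chart i (chart_inv i y) = y.
Proof. by move=> [q qi <-]; rewrite chartK. Qed.

Lemma chart_codom_nbhs i q : chart_dom i q ->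
  \forall y \near chart i q, (chart i @` chart_dom i) y.
Proof.
move=> qi; apply: open_nbhs_nbhs; split; first exact: chart_codom_open.
by exists q.
Qed.

Lemma chart_dom_nbhs i q : chart_dom i q -> \forall q' \near q, chart_dom i q'.
Proof. by move=> qi; apply: open_nbhs_nbhs; split=> //; exact: chart_dom_open. Qed.

Lemma chart_inv_near i q (P : set M) : chart_dom i q -> (\forall q' \near q, P q') ->
  \forall y \near chart i q, P (chart_inv i y).
Proof.
move=> qi qP; have := chart_inv_continuous qi; apply.
by rewrite chartK.
Qed.

Lemma chart_near i q (P : set V) : chart_dom i q ->
  (\forall y \near chart i q, P y) -> \forall q' \near q, P (chart i q').
Proof. by move=> qi; exact: (chart_continuous qi). Qed.

Lemma transition_C (m : nat) i j q : chart_dom i q -> chart_dom j q ->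
  exists O, [/\ open O, O (chart i q) & Ck_on m O (transition i j)].
Proof. by move=> qi qj; have [U [oU Uq CU]] := transition_smooth qi qj; exists U. Qed.

Lemma transition_diff i j q : chart_dom i q -> chart_dom j q ->
  differentiable (transition i j) (chart i q).
Proof.
by move=> qi qj; have [U [_ Uq [+ _]]] := transition_C 1 qi qj; apply.
Qed.

Lemma diff_transitionK i j k q v :
  chart_dom i q -> chart_dom j q -> chart_dom k q ->
  'd (transition j k) (chart j q) ('d (transition i j) (chart i q) v) =
  'd (transition i k) (chart i q) v.
Proof.
move=> qi qj qk.
have dij := transition_diff qi qj; have dik := transition_diff qi qk.
have E : transition i j (chart i q) = chart j q by rewrite /transition /= chartK.
have djk : differentiable (transition j k) (transition i j (chart i q)).
  by rewrite E; exact: transition_diff.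
have dc := diff_comp dij djk; rewrite E in dc.
rewrite -[LHS]/(('d (transition j k) (chart j q) \o 'd (transition i j) (chart i q)) v).
rewrite -dc.
have H := chart_inv_near qi (chart_dom_nbhs qj).
have nE : \forall y \near chart i q,
    transition i k y = (transition j k \o transition i j) y.
  by near=> y; rewrite /transition /= chartK //; exact: (near H y).
exact: (congr1 (fun h : V -> V => h v) (near_eq_diff nE dik).2).
Unshelve. all: by end_near. Qed.

Lemma diff_transition_id i q v : chart_dom i q ->
  'd (transition i i) (chart i q) v = v.
Proof.
move=> qi.
have di : differentiable (id : V -> V) (chart i q) by [].
have H := chart_codom_nbhs qi.
have nE : \forall y \near chart i q, (id : V -> V) y = transition i i y.
  near=> y; have Hy : (chart i @` chart_dom i) y by exact: (near H y).
  by have [_ E] := chart_invK Hy; rewrite /transition /= E.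
have dE := (near_eq_diff nE di).2.
by apply: (etrans (congr1 (fun h : V -> V => h v) dE)); rewrite diff_val.
Unshelve. all: by end_near. Qed.

End Charts.

(** * Closed one-forms on compact manifolds *)

Section Forms.
Variables (R : realType) (n : nat) (M : topologicalType).
Variable A : smooth_manifold R n M.
Local Notation V := 'rV[R]_n.
Implicit Types (i j : chart_index A) (q : M) (v w y : V).
Variable alpha : M -> V -> R.
Hypothesis alpha_form : one_form A alpha.
Hypothesis alpha_closed : forall p X Y, smooth_vf A X p -> smooth_vf A Y p ->
  ext_d1 A alpha X Y p = 0.

(** The field whose components in the chart i are the constant vector v. *)
Definition coord_field i v : M -> V :=
  fun q => 'd (transition i (chart_at A q)) (chart i q) v.

(** The components of alpha in the chart i, at the point of coordinates y. *)
Definition form_rep i y v : R :=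
  alpha (chart_inv i y) (coord_field i v (chart_inv i y)).

Lemma vf_rep_coord_field i v y : (chart i @` chart_dom i) y ->
  vf_rep i (coord_field i v) y = v.
Proof.
move=> /chart_invK [iq E]; rewrite /vf_rep /coord_field.
set q := chart_inv i y.
rewrite -[_ \o _]/(transition (chart_at A q) i).
rewrite diff_transitionK //; first exact: diff_transition_id.
exact: chart_dom_at.
Qed.

(** In the preferred chart of q, in which smoothness at q is tested, the field is
    constant. *)
Lemma smooth_coord_field q v : smooth_vf A (coord_field (chart_at A q) v) q.
Proof.
set c := chart_at A q.
exists (chart c @` chart_dom c); split.
- exact: chart_codom_open.
- by exists q => //; exact: chart_dom_at.
- move=> k; apply: (@Ck_on_eq _ _ _ k _ (fun=> v)).
  + exact: chart_codom_open.
  + by move=> y cy; rewrite vf_rep_coord_field.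
  + exact: Ck_on_cst.
Qed.

Lemma form_rep_scalar i y : scalar (form_rep i y).
Proof.
by move=> k v w; rewrite /form_rep /coord_field linearP; case: alpha_form => -> _.
Qed.

Lemma form_rep_smooth q v :
  smooth_near (fun y => form_rep (chart_at A q) y v) (chart (chart_at A q) q).
Proof.
by have [_] := alpha_form; apply; exact: smooth_coord_field.
Qed.

Lemma coord_field_base q v : coord_field (chart_at A q) v q = v.
Proof. by rewrite /coord_field diff_transition_id //; exact: chart_dom_at. Qed.

Lemma form_rep_base q v :
  form_rep (chart_at A q) (chart (chart_at A q) q) v = alpha q v.
Proof.
rewrite /form_rep chartK; last exact: chart_dom_at.
by rewrite coord_field_base.
Qed.

Lemma form_rep_transition i j q v : chart_dom i q -> chart_dom j q ->
  form_rep i (chart i q) v =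
  form_rep j (chart j q) ('d (transition i j) (chart i q) v).
Proof.
move=> qi qj; rewrite /form_rep (chartK qi) (chartK qj) /coord_field.
exact: (congr1 (alpha q) (esym (diff_transitionK v qi qj (chart_dom_at A q)))).
Qed.

(** The equation d alpha (X, Y) = 0 for two constant fields in the preferred chart
    of q: their bracket at q is zero. *)
Lemma form_rep_closed_base q v w : let c := chart_at A q in
  'd (form_rep c ^~ v) (chart c q) w = 'd (form_rep c ^~ w) (chart c q) v.
Proof.
move=> c.
have := alpha_closed (smooth_coord_field q w) (smooth_coord_field q v).
have bracket0 u u' : 'd (vf_rep c (coord_field c u)) (chart c q) u' = 0.
  have d0 : differentiable (fun _ : V => u) (chart c q) by exact: differentiable_cst.
  have H := chart_codom_nbhs (chart_dom_at A q).
  have nE : \forall y \near chart c q,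
      (fun=> u) y = vf_rep c (coord_field c u) y.
    by near=> y; rewrite vf_rep_coord_field //; exact: (near H y).
  have dE := (near_eq_diff nE d0).2.
  by apply: (etrans (congr1 (fun h : V -> V => h u') dE)); rewrite diff_cst.
have L0 : lie_bracket A (coord_field c w) (coord_field c v) q = 0.
  apply/eqP; rewrite subr_eq0; apply/eqP.
  exact: (etrans (bracket0 _ _) (esym (bracket0 _ _))).
have a0 : alpha q 0 = 0.
  have [al _] := alpha_form; have := al q (- 1) 0 0.
  by rewrite scaler0 addr0 mulN1r addNr.
have E u u' : vf_deriv A (coord_field c u) (fun q => alpha q (coord_field c u' q)) q
    = 'd (form_rep c ^~ u') (chart c q) u.
  exact: (congr1 ('d (form_rep c ^~ u') (chart c q)) (coord_field_base q u)).
by rewrite /ext_d1 L0 a0 subr0 !E => /subr0_eq.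
Unshelve. all: by end_near. Qed.

Lemma transition_schwarz i j q v w (k : 'I_n) : chart_dom i q -> chart_dom j q ->
  'd (fun y => 'd (transition i j) y v) (chart i q) w ord0 k =
  'd (fun y => 'd (transition i j) y w) (chart i q) v ord0 k.
Proof.
move=> qi qj.
have [U [oU Uq [df C1f]]] := transition_C 2 qi qj.
have nU : \forall y \near chart i q, U y by exact: open_nbhs_nbhs.
set f := transition i j in df C1f *.
have D1 u : \forall y \near chart i q,
    is_derive y u (fun y => f y ord0 k) ('d f y u ord0 k).
  near=> y; apply: is_derive_coord; apply: is_derive_diff; apply: df.
  exact: (near nU y).
have D2 u u' : \forall y \near chart i q,
    is_derive y u' (fun y => 'd f y u ord0 k) ('d (fun y => 'd f y u) y u' ord0 k).
  near=> y; apply: (is_derive_coord (f := fun y => 'd f y u)).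
  apply: is_derive_diff; have [+ _] := C1f u; apply; exact: (near nU y).
have D3 u u' : {for chart i q,
    continuous (fun y => 'd (fun y => 'd f y u) y u' ord0 k)}.
  apply: (@continuous_comp _ _ _ (fun y => 'd (fun y => 'd f y u) y u')
      (fun x : V => x ord0 k)); last exact: coord_continuous.
  by have [_ /(_ u')] := C1f u; apply.
exact: (schwarz (D1 v) (D1 w) (D2 v w) (D2 w v) (D3 v w) (D3 w v)).
Unshelve. all: by end_near. Qed.

Lemma form_rep_diff i y v :
  (forall k, differentiable (fun x => form_rep i x (delta_mx ord0 k)) y) ->
  differentiable (form_rep i ^~ v) y /\
  forall w, 'd (form_rep i ^~ v) y w =
    \sum_k v ord0 k * 'd (fun x => form_rep i x (delta_mx ord0 k)) y w.
Proof.
move=> dk.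
pose b (k : 'I_n) (x : V) := form_rep i x (delta_mx ord0 k).
have E : form_rep i ^~ v = \sum_k (v ord0 k *: b k).
  apply/funext => z; rewrite (scalar_coordE v (form_rep_scalar i z)) fct_sumE.
  by [].
have dE : differentiable (form_rep i ^~ v) y.
  rewrite E; apply: differentiable_sum => k; apply: differentiableZ; exact: dk.
split=> // w; apply: (diff_derive_val dE).
have -> : form_rep i ^~ v = fun x => \sum_k v ord0 k *: b k x.
  by rewrite E; apply/funext => x; rewrite fct_sumE.
apply: is_derive_sum_fun => k.
have S := is_derive_diff w (dk k).
exact: (is_deriveZ (v ord0 k) S).
Qed.

(** Let f be the transition map to the preferred chart of q, where alpha has
    the components b k.  The derivative in the direction w of the component of
    alpha along v is the sum of a term in the second derivative of f, symmetric by
    Schwarz's theorem, and of the derivative of the b k evaluated at the images of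
    v and w, symmetric by the previous case. *)
Lemma form_rep_closed i q v w : chart_dom i q ->
  (forall v, differentiable (form_rep i ^~ v) (chart i q)) ->
  'd (form_rep i ^~ v) (chart i q) w = 'd (form_rep i ^~ w) (chart i q) v.
Proof.
move=> qi di.
pose c := chart_at A q.
have qc : chart_dom c q by exact: chart_dom_at.
set y := chart i q in di *.
pose f := transition i c; pose z := f y.
have zE : chart c q = z by rewrite /z /f /transition /= chartK.
pose b (k : 'I_n) (x : V) := form_rep c x (delta_mx ord0 k).
have db k : differentiable (b k) z.
  rewrite -zE.
  have [U [oU Uq /(_ 1) [+ _]]] := form_rep_smooth q (delta_mx ord0 k).
  exact.
have [U [oU Uy [df C1f]]] := transition_C 2 qi qc.
have dfy : differentiable f y by exact: df.
have ddf u : differentiable (fun y => 'd f y u) y by have [+ _] := C1f u; apply.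
have D u u' : 'd (form_rep i ^~ u) y u' =
    \sum_k ('d f y u ord0 k * 'd (b k) z ('d f y u') +
            b k z * 'd (fun y => 'd f y u) y u' ord0 k).
  have H1 := chart_inv_near qi (chart_dom_nbhs qc).
  have H2 := chart_codom_nbhs qi.
  have nE : \forall y' \near y, \sum_k 'd f y' u ord0 k * b k (f y') =
      form_rep i y' u.
    near=> y'.
    have Hy' : (chart i @` chart_dom i) y' by exact: (near H2 y').
    have [iq' Eq'] := chart_invK Hy'.
    have cq' : chart_dom c (chart_inv i y') by exact: (near H1 y').
    have := form_rep_transition u iq' cq'; rewrite Eq' => ->.
    exact/esym/(scalar_coordE _ (form_rep_scalar c _)).
  have S : is_derive y u' (fun y' => \sum_k 'd f y' u ord0 k * b k (f y'))
    (\sum_k ('d f y u ord0 k * 'd (b k) z ('d f y u') +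
            b k z * 'd (fun y => 'd f y u) y u' ord0 k)).
    apply: is_derive_sum_fun => k.
    have E1 : is_derive y u' (fun y => 'd f y u ord0 k)
        ('d (fun y => 'd f y u) y u' ord0 k).
      apply: (is_derive_coord (f := fun y => 'd f y u)).
      exact: is_derive_diff.
    have E2 := is_derive_chain u' dfy (db k).
    exact: (is_deriveM E1 E2).
  exact: (diff_derive_val (di u) (near_eq_is_derive nE S)).
have expand u x : 'd (b u) z x = \sum_l x ord0 l * 'd (b u) z (delta_mx ord0 l).
  exact: (scalar_coordE x (fun k x y => linearP ('d (b u) z) k x y)).
pose B k l := 'd (b k) z (delta_mx ord0 l).
pose H k u u' := 'd (fun y => 'd f y u) y u' ord0 k.
have DB u u' : 'd (form_rep i ^~ u) y u' =
    (\sum_k \sum_l 'd f y u ord0 k * ('d f y u' ord0 l * B k l)) +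
    \sum_k b k z * H k u u'.
  apply: (etrans (D u u')); rewrite big_split; congr (_ + _).
  by apply: eq_bigr => k _; rewrite (expand k) mulr_sumr.
have BC k l : B k l = B l k.
  by rewrite /B /b -zE; exact: (form_rep_closed_base q).
have HC k : H k v w = H k w v by exact: transition_schwarz.
apply: (etrans (DB v w)); apply: esym; apply: (etrans (DB w v)).
congr (_ + _); last by apply: eq_bigr => k _; rewrite HC.
rewrite exchange_big; apply: eq_bigr => k _; apply: eq_bigr => l _.
by rewrite mulrCA BC.
Unshelve. all: by end_near. Qed.

(** The components of alpha along the basis vectors are smooth on a common ball;
    the Poincare lemma applies there. *)
Lemma local_primitive q : exists e, 0 < e /\ exists f : V -> R,
  forall y, ball (chart (chart_at A q) q) e y ->
    (chart (chart_at A q) @` chart_dom (chart_at A q)) y /\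
    is_diff y f (form_rep (chart_at A q) y).
Proof.
set c := chart_at A q; set y0 := chart c q.
have qc : chart_dom c q by exact: chart_dom_at.
pose b (k : 'I_n) (x : V) := form_rep c x (delta_mx ord0 k).
have /choice [U HU] : forall k, exists U : set V,
    [/\ open U, U y0 & forall m, Ck_on m U (b k)].
  by move=> k; exact: form_rep_smooth.
have nU : \forall y \near y0, forall k, U k y.
  apply: (@filter_forall _ _ (fun k y => U k y) (nbhs y0)) => k.
  by have [oU Uq _] := HU k; exact: open_nbhs_nbhs.
have nC := chart_codom_nbhs qc.
have /nbhs_ballP [e /= e0 He] : \forall y \near y0,
    (chart c @` chart_dom c) y /\ forall k, U k y.
  by near=> y; split; [exact: (near nC y)|exact: (near nU y)].
exists e; split=> //.
have db k y : ball y0 e y -> differentiable (b k) y.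
  by move=> /He [_ Uy]; have [_ _ /(_ 1) [+ _]] := HU k; apply; exact: Uy.
have bC1 k y w : ball y0 e y -> {for y, continuous (fun y => 'd (b k) y w)}.
  move=> /He [_ Uy]; have [_ _ /(_ 1) [_ /(_ w)]] := HU k.
  by apply; exact: Uy.
have da v y : ball y0 e y -> differentiable (form_rep c ^~ v) y.
  by move=> yB; have [] := form_rep_diff v (fun k => db k y yB).
have ballnear y : ball y0 e y -> \forall z \near y, ball y0 e z.
  by move=> yB; apply: open_nbhs_nbhs; split=> //; exact: ball_open.
have aC1 y v w : ball y0 e y ->
    {for y, continuous (fun y => 'd (form_rep c ^~ v) y w)}.
  move=> yB; apply: (@near_eq_continuous _ _ (fun y => \sum_k v ord0 k * 'd (b k) y w)).
    have nb := ballnear y yB; near=> z; apply: esym.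
    have zB : ball y0 e z by exact: (near nb z).
    exact: ((form_rep_diff v (fun k => db k z zB)).2 w).
  apply: continuous_sum_fun => k; apply: continuousM; last exact: bC1.
  exact: cst_continuous.
have asym y v w : ball y0 e y ->
    'd (form_rep c ^~ v) y w = 'd (form_rep c ^~ w) y v.
  move=> yB; have [Cy _] := He y yB; have [cy' E] := chart_invK Cy.
  have := @form_rep_closed c (chart_inv c y) v w cy'; rewrite E; apply.
  by move=> u; exact: da.
have Fd y h : ball y0 e y ->
    is_derive y h (radial_integral (form_rep c) y0) (form_rep c y h).
  exact: (@radial_integral_derive R n (form_rep c) y0 e (form_rep_scalar c)
    (fun z v zB => da v z zB) (fun z v w zB => aC1 z v w zB)
    (fun z v w zB => asym z v w zB)).
exists (radial_integral (form_rep c) y0) => y yB; split; first by case: (He y yB).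
apply: C1_diff.
- exact: form_rep_scalar.
- have nb := ballnear y yB; near=> z => h; apply: Fd; exact: (near nb z).
- by move=> h; apply: differentiable_continuous; exact: da.
Unshelve. all: by end_near. Qed.

Lemma transition_preserves_primitive (i j : chart_index A) (F G : V -> R) q h :
  chart_dom i q -> chart_dom j q ->
  is_diff (chart i q) F (form_rep i (chart i q)) ->
  is_diff (chart j q) G (form_rep j (chart j q)) ->
  is_derive (chart i q) h (fun y => G (transition i j y) - F y) 0.
Proof.
move=> qi qj [dF dFE] [dG dGE].
have dt := transition_diff qi qj.
have E : transition i j (chart i q) = chart j q by rewrite /transition /= chartK.
have dG' : differentiable G (transition i j (chart i q)).
  by rewrite E; exact: dG.
have D1 := is_derive_chain h dt dG'.
have D2 := is_derive_diff h dF.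
have E1 : 'd G (transition i j (chart i q)) ('d (transition i j) (chart i q) h) =
    form_rep i (chart i q) h.
  rewrite E; apply: etrans (congr1 (fun u : V -> R => u _) dGE) _.
  by apply: esym; exact: form_rep_transition.
have E2 : 'd F (chart i q) h = form_rep i (chart i q) h.
  exact: (congr1 (fun u : V -> R => u h) dFE).
have Z := etrans (congr2 (fun a b : R => a - b) E1 E2) (subrr _).
exact: (is_derive_eq (is_deriveB D1 D2) Z).
Qed.

Section LocalPrimitives.
Variables (radius : M -> R) (prim : M -> V -> R).
Local Notation c q := (chart_at A q).
Local Notation base q := (chart (c q) q).
Hypothesis radius_gt0 : forall q, 0 < radius q.
Hypothesis primP : forall q y, ball (base q) (radius q) y ->
  (chart (c q) @` chart_dom (c q)) y /\ is_diff y (prim q) (form_rep (c q) y).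

Definition increment q q' : R := prim q (chart (c q) q') - prim q (base q).

Definition primitive_dom q : set M :=
  [set q' | chart_dom (c q) q' /\ ball (base q) (radius q) (chart (c q) q')].

Lemma primitive_dom_near q : \forall q' \near q, primitive_dom q q'.
Proof.
have qc := chart_dom_at A q.
have n1 := chart_dom_nbhs qc.
have n2 : \forall y \near base q, ball (base q) (radius q) y.
  exact: nbhsx_ballx.
have n3 := chart_near qc n2.
by near=> q'; split; [exact: (near n1 q')|exact: (near n3 q')].
Unshelve. all: by end_near. Qed.

(** Two primitives of alpha, read in two charts, have the same differential, so
    their difference is constant on a ball, hence along segments of it. *)
Lemma increment_cocycle q q' : primitive_dom q q' ->
  \forall q'' \near q', increment q q'' = increment q q' + increment q' q''.
Proof.
move=> [cq' bq']; have qc' := chart_dom_at A q'.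
pose t := transition (c q') (c q).
have n1 := chart_inv_near qc' (chart_dom_nbhs cq').
have nb : \forall y \near chart (c q) q', ball (base q) (radius q) y.
  by apply: open_nbhs_nbhs; split=> //; exact: ball_open.
have n2 := chart_inv_near qc' (chart_near cq' nb).
have n3 : \forall z \near base q', ball (base q') (radius q') z.
  exact: nbhsx_ballx.
have /nbhs_ballP [r /= r0 Hr] : \forall z \near base q',
    [/\ chart_dom (c q) (chart_inv (c q') z),
       ball (base q) (radius q) (chart (c q) (chart_inv (c q') z)) &
       ball (base q') (radius q') z].
  by near=> z; split; [exact: (near n1 z)|exact: (near n2 z)|exact: (near n3 z)].
pose g z := prim q (t z) - prim q' z.
have gd z h : ball (base q') r z -> is_derive z h g 0.
  move=> /Hr [cz bz bz'].
  have [Cz dz'] := primP bz'.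
  have [_ dz] := primP bz.
  have [cz' Ez] := chart_invK Cz.
  have := @transition_preserves_primitive (c q') (c q) (prim q') (prim q)
    (chart_inv (c q') z) h cz' cz; rewrite Ez.
  by apply.
have gcst z : ball (base q') r z -> g z = g (base q').
  move=> bz.
  have [s s01|s _] := @MVT_line R V g (fun=> 0) (base q') (z - base q') 1 ltr01.
    apply: gd; case/andP: s01 => s0 s1.
    move: bz; rewrite -ball_normE /ball_ /= opprD addNKr normrN normrZ distrC.
    by rewrite ger0_norm //; apply: le_lt_trans; rewrite ler_piMl.
  by rewrite scale1r [base q' + _]addrC subrK mulr0 => /subr0_eq.
have n4 : \forall z \near base q', ball (base q') r z by exact: nbhsx_ballx.
have n5 := chart_near qc' n4.
have n6 := chart_dom_nbhs qc'.
near=> q''.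
have b'' : ball (base q') r (chart (c q') q'') by exact: (near n5 q'').
have d'' : chart_dom (c q') q'' by exact: (near n6 q'').
have := gcst _ b''; rewrite /g /t /transition /= (chartK d'') (chartK qc').
rewrite /increment; lra.
Unshelve. all: by end_near. Qed.

(** The segment between the two points in the chart around q is a path of M, and
    it lifts to its leaf by the increment itself. *)
Lemma increment_linked q q' : primitive_dom q q' ->
  linked R (leaf increment) (q, 0) (q', increment q q').
Proof.
move=> [cq' bq']; have qc := chart_dom_at A q.
pose l (s : R) := base q + s *: (chart (c q) q' - base q).
have lb s : 0 <= s <= 1 -> ball (base q) (radius q) (l s).
  move=> /andP[s0 s1]; move: bq'.
  rewrite -ball_normE /ball_ /= opprD addNKr normrN normrZ distrC.
  by rewrite ger0_norm //; apply: le_lt_trans; rewrite ler_piMl.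
have lC s : 0 <= s <= 1 -> chart_dom (c q) (chart_inv (c q) (l s)) /\
    chart (c q) (chart_inv (c q) (l s)) = l s.
  by move=> s01; apply: chart_invK; have [] := primP (lb s s01).
have l0 : l 0 = base q by rewrite /l scale0r addr0.
have l1 : l 1 = chart (c q) q' by rewrite /l scale1r addrC subrK.
exists (fun s => (chart_inv (c q) (l s), increment q (chart_inv (c q) (l s)) + 0)).
split; last 2 first.
- by rewrite l0 (chartK qc) /increment subrr addr0.
- by rewrite l1 (chartK cq') addr0.
apply: (leaf_path_local (g := fun s => chart_inv (c q) (l s))).
  move=> s s01 P NP.
  have [Cs Es] := lC s s01.
  have n1 := chart_inv_near Cs NP; rewrite Es in n1.
  have lc : {for s, continuous l}.
    by apply: cvgD; [exact: cvg_cst|exact: scalel_continuous].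
  have n2 : \forall s' \near s, P (chart_inv (c q) (l s')) by exact: (lc _ n1).
  by near=> s' => _; exact: (near n2 s').
move=> s s01; have [Cs Es] := lC s s01.
apply: increment_cocycle; split; first exact: Cs.
by rewrite Es; exact: lb.
Unshelve. all: by end_near. Qed.

Lemma increment_continuous q : {for q, continuous (increment q)}.
Proof.
apply: continuousB; last exact: cst_continuous.
apply: (@continuous_comp _ _ _ (chart (c q)) (prim q)).
  exact: (chart_continuous (chart_dom_at A q)).
apply: differentiable_continuous.
by have [_ []] := primP (ballxx (base q) (radius_gt0 q)).
Qed.

(** Fermat: the derivative of the increment at q in the direction v, which is
    alpha q v, vanishes at a local maximum. *)
Lemma increment_local_max q v :
  (\forall q' \near q, increment q q' <= 0) -> alpha q v = 0.
Proof.
move=> max0; have qc := chart_dom_at A q.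
have n1 := chart_inv_near qc max0.
have n2 := chart_codom_nbhs qc.
have n3 : \forall y \near base q, ball (base q) (radius q) y.
  exact: nbhsx_ballx.
have /nbhs_ballP [r /= r0 Hr] : \forall t \near (0 : R),
    prim q (base q + t *: v) <= prim q (base q + 0 *: v) /\
    ball (base q) (radius q) (base q + t *: v).
  have lc : {for 0 : R, continuous (fun t : R => base q + t *: v)}.
    by apply: cvgD; [exact: cvg_cst|exact: scalel_continuous].
  have nn : \forall y \near base q + 0 *: v,
      prim q y <= prim q (base q + 0 *: v) /\ ball (base q) (radius q) y.
    rewrite !scale0r !addr0; near=> y; split; last exact: (near n3 y).
    have Cy : (chart (c q) @` chart_dom (c q)) y by exact: (near n2 y).
    have [_ Ey] := chart_invK Cy.
    have : increment q (chart_inv (c q) y) <= 0 by exact: (near n1 y).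
    by rewrite /increment Ey subr_le0.
  exact: (lc _ nn).
have inr t : t \in `](- r), r[ -> ball (0 : R) r t.
  by rewrite in_itv /= -ball_normE /ball_ /= sub0r normrN ltr_norml.
pose h (t : R) := prim q (base q + t *: v).
have hd t : t \in `](- r), r[ ->
    is_derive t (1 : R) h ('d (prim q) (base q + t *: v) v).
  move=> /inr /Hr [_ bt]; apply: is_derive_line; apply: is_derive_diff.
  by have [_ []] := primP bt.
have i0 : (0 : R) \in `](- r), r[ by rewrite in_itv /= oppr_lt0 r0.
have [_ h0] : is_derive (0 : R) (1 : R) h 0.
  apply: (@derive1_at_max _ h (- r) r 0) => //.
  - by rewrite ge0_cp ?ltW.
  - by move=> t ti; have [] := hd t ti.
  - by move=> t ti; have [] := Hr t (inr t ti).
have [_ h0'] := hd 0 i0.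
have := etrans (esym h0') h0; rewrite scale0r addr0 => dfv.
have [_ [_ dfE]] := primP (ballxx (base q) (radius_gt0 q)).
apply: etrans (etrans (esym (congr1 (fun u : V -> R => u v) dfE)) dfv).
by apply: esym; exact: form_rep_base.
Unshelve. all: by end_near. Qed.

End LocalPrimitives.

(** The finiteness of the fundamental group makes alpha exact, and the
    compactness gives a maximum to its primitive. *)
Lemma closed_form_vanishes : [set: M] !=set0 -> compact [set: M] ->
  finite_fundamental_group R M -> exists q, forall v, alpha q v = 0.
Proof.
move=> [p0 _] Mc Mpi.
have /choice [radius Hradius] := local_primitive.
have radius_gt0 q : 0 < radius q by have [] := Hradius q.
have /choice [prim primP] : forall q, exists f : V -> R,
  forall y, ball (chart (chart_at A q) q) (radius q) y ->
    (chart (chart_at A q) @` chart_dom (chart_at A q)) y /\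
    is_diff y f (form_rep (chart_at A q) y).
  by move=> q; have [] := Hradius q.
pose dom := primitive_dom radius.
have dom_near q : \forall q' \near q, dom q q' by exact: primitive_dom_near.
have cocycle q : \forall q' \near q, \forall q'' \near q',
    increment prim q q'' = increment prim q q' + increment prim q' q''.
  have nd := dom_near q; near=> q'.
  by apply: (increment_cocycle radius_gt0 primP); exact: (near nd q').
have lnear q : \forall q' \near q,
    linked R (leaf (increment prim)) (q, 0) (q', increment prim q q').
  have nd := dom_near q; near=> q'.
  by apply: (increment_linked radius_gt0 primP); exact: (near nd q').
have [phi Hphi] := global_primitive cocycle Mpi lnear p0.
have phi_cont : continuous phi.
  move=> q.
  apply: (@near_eq_continuous _ _ (fun q' => phi q + increment prim q q')).
    by have nH := Hphi q; near=> q'; apply: esym; exact: (near nH q').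
  apply: continuousD; first exact: cst_continuous.
  exact: (increment_continuous radius_gt0 primP).
have [q _ qmax] : exists2 q, q \in [set: M] &
    forall q', q' \in [set: M] -> phi q' <= phi q.
  apply: compact_EVT_max => //; first by exists p0.
  exact: continuous_subspaceT.
exists q => v; apply: (increment_local_max radius_gt0 primP).
have nH := Hphi q; near=> q'.
have E : phi q' = phi q + increment prim q q' by exact: (near nH q').
have := qmax q'; rewrite in_setT => /(_ isT); rewrite E; lra.
Unshelve. all: by end_near. Qed.

End Forms.

(** * The dual form of a parallel field *)

(** X g(E, Y) = g(nabla_X E, Y) + g(E, nabla*_X Y) and the first term is zero, so the
    exterior derivative is g(E, .) of the torsion of nabla*. *)
Lemma parallel_dual_form_closed (R : realType) (n : nat) (M : topologicalType)
    (A : smooth_manifold R n M) (g : M -> 'rV[R]_n -> 'rV[R]_n -> R)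
    (E : M -> 'rV[R]_n)
    (nabla nablas : (M -> 'rV[R]_n) -> (M -> 'rV[R]_n) -> M -> 'rV[R]_n) :
  (forall p, bilinear_form (g p)) -> dual_connections A g nabla nablas ->
  torsion_free A nablas -> (forall p, smooth_vf A E p) -> parallel_vf A nabla E ->
  forall p X Y, smooth_vf A X p -> smooth_vf A Y p ->
    ext_d1 A (fun q => g q (E q)) X Y p = 0.
Proof.
move=> gbil dual tors Esm Epar p X Y Xsm Ysm.
have [gl gr] := gbil p.
have g0 w : g p 0 w = 0.
  by have := gl w (- 1) 0 0; rewrite /= scaler0 addr0 mulN1r addNr.
have D Z W : smooth_vf A Z p -> smooth_vf A W p ->
    vf_deriv A Z (fun q => g q (E q) (W q)) p = g p (E p) (nablas Z W p).
  by move=> Zsm Wsm; rewrite dual // Epar // g0 add0r.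
rewrite /ext_d1 !D // -tors //.
have gB v w : g p (E p) (v - w) = g p (E p) v - g p (E p) w.
  by rewrite addrC -scaleN1r gr mulN1r addrC.
by rewrite gB subrr.
Qed.

Theorem proposition4p10 (R : realType) (d : nat) (M : topologicalType)
    (A : smooth_manifold R d.*2.+1 M)
    (Omega : M -> 'rV[R]_(d.*2.+1) -> 'rV[R]_(d.*2.+1) -> R)
    (alpha : M -> 'rV[R]_(d.*2.+1) -> R)
    (E : M -> 'rV[R]_(d.*2.+1))
    (M_nonempty : [set: M] !=set0)
    (M_compact : compact [set: M])
    (shs : stable_hamiltonian A Omega alpha)
    (reeb : reeb_field A Omega alpha E)
    (pi1_finite : finite_fundamental_group R M)
    (nabla nablas : (M -> 'rV[R]_(d.*2.+1)) -> (M -> 'rV[R]_(d.*2.+1)) ->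
                    (M -> 'rV[R]_(d.*2.+1)))
    (smat : SMAT_connection A Omega alpha E nabla nablas) :
  ~ statistical A nabla nablas.
Proof.
case: shs => _ alpha_form _ _; case: reeb => E_smooth _ alphaE.
case: smat => _ [g [[[g_bil _] g_sym _] [Th [_ Th_compat]]] dual] _ E_parallel _.
move=> [_ tors].
have alpha_g : alpha = fun p => g p (E p).
  apply/funext => p; apply/funext => v.
  by have [_ _ _ -> _] := Th_compat p; exact: g_sym.
have alpha_closed p X Y : smooth_vf A X p -> smooth_vf A Y p ->
    ext_d1 A alpha X Y p = 0.
  rewrite alpha_g.
  exact: (parallel_dual_form_closed g_bil dual tors E_smooth E_parallel).
have [q alpha0] := closed_form_vanishes alpha_form alpha_closed M_nonempty
  M_compact pi1_finite.
by have := alphaE q; rewrite alpha0 => /eqP; rewrite eq_sym oner_eq0.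
Qed.
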